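(* Let $Y$ be the bounded strong solution of the put-side obstacle problem and let $\widetilde A(\tau)=\min\{x:x\ge\ln K_2,\ Y(x,\tau)=k_2-K_1\}$, $\tau\in(0,T]$, be its outer free boundary. Then, with $\widetilde A(0):=\lim_{\tau\searrow0}\widetilde A(\tau)$, the function $\widetilde A$ is strictly increasing and continuous on $[0,T]$, and $$\widetilde A(0)=\lim_{\tau\searrow0}\widetilde A(\tau)=\ln K_2.$$
   Context: Constants: $0<K_1<k_1<k_2<K_2$, $\sigma>0$, $r>0$, $q\ge0$, $T>0$. Put $\mathcal Lu:=\frac{\sigma^2}{2}\partial_{xx}u+\left(r-q-\frac{\sigma^2}{2}\right)\partial_xu-ru$ and $\psi_2(x):=(K_2-e^x)^++k_2-K_1$. Let $Q=(\ln k_2,\infty)\times(0,T]$. For $1<p<\infty$, $\mathcal W_p(Q)$ is the set of $u\in C([\ln k_2,\infty)\times[0,T])$ such that, for all $R,\rho>0$, $u,\partial_xu,\partial_{xx}u,\partial_\tau u$ (weak derivatives) belong to $L^p$ of $\left(((\ln k_2,\infty)\cap(-R,R))\times(0,T)\right)\setminus B_\rho(\ln K_2,0)$, where $B_\rho$ denotes an open disc of radius $\rho$. A strong solution of the put-side obstacle problem is a function $Y\in\mathcal W_p(Q)$ with $Y\ge\psi_2$ in $Q$, $\partial_\tau Y-\mathcal LY\ge0$ almost everywhere in $Q$, $\partial_\tau Y-\mathcal LY=0$ almost everywhere on $\{Y>\psi_2\}$, $Y(x,0)=\psi_2(x)$ for $x>\ln k_2$, and $Y(\ln k_2,\tau)=K_2-K_1$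 for $\tau\in[0,T]$. For every $1<p<\infty$ there is exactly one bounded strong solution, and it does not depend on $p$. For each $\tau\in(0,T]$ the set $\{x\ge\ln K_2:Y(x,\tau)=k_2-K_1\}$ is nonempty and closed, so $\widetilde A(\tau)$ is well defined. *)

(* Defs.v *)
From HB Require Import structures.
From mathcomp Require Import all_boot all_order all_algebra.
From mathcomp Require Import all_classical all_reals all_analysis.

Set Implicit Arguments.
Unset Strict Implicit.
Unset Printing Implicit Defensive.

Import Order.TTheory GRing.Theory Num.Theory.
Import numFieldNormedType.Exports.

Local Open Scope classical_set_scope.
Local Open Scope ring_scope.

(* Points of the plane are pairs [z = (x, tau)]. *)

Section WeakDerivatives.
Context {R : realType}.
Implicit Types (Omega D : set (R * R)) (f g phi u : R * R -> R).

Local Notation mR := (measurableTypeR R).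
Definition leb2 : {measure set (mR * mR) -> \bar R} :=
  (@lebesgue_measure R \x @lebesgue_measure R)%E.

Definition dx f : R * R -> R := fun z => 'D_((1, 0) : R * R) f z.
Definition dtau f : R * R -> R := fun z => 'D_((0, 1) : R * R) f z.

Fixpoint Ck (n : nat) f : Prop :=
  continuous f /\
  if n is m.+1 then
    [/\ forall z, derivable f z ((1, 0) : R * R),
        forall z, derivable f z ((0, 1) : R * R),
        Ck m (dx f) & Ck m (dtau f)]
  else True.

Definition test_function Omega phi : Prop :=
  (forall n, Ck n phi) /\
  exists K, [/\ compact K, K `<=` Omega & forall z, ~ K z -> phi z = 0].

Definition loc_integrable Omega f : Prop :=
  forall K, compact K -> K `<=` Omega -> leb2.-integrable K (EFin \o f).

(* [g] is the weak derivative of [f] in the open set [Omega], taken [i] times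
   in [x] and [j] times in [tau]. *)
Definition weak_derivative Omega (i j : nat) f g : Prop :=
  [/\ loc_integrable Omega f, loc_integrable Omega g &
      forall phi, test_function Omega phi ->
        \int[leb2]_(z in Omega) (f z * iter i dx (iter j dtau phi) z) =
        (-1) ^+ (i + j) * \int[leb2]_(z in Omega) (g z * phi z)].

Definition Lp_on (p : R) D f : Prop := f \_ D \in Lfun leb2 p%:E.

(* The Euclidean disc; the library's [ball] on [R * R] is a square. *)
Definition disc (c : R * R) (rho : R) : set (R * R) :=
  [set z | (z.1 - c.1) ^+ 2 + (z.2 - c.2) ^+ 2 < rho ^+ 2].

End WeakDerivatives.

Section PutSideObstacleProblem.
Context {R : realType}.
Variables (K1 k2 K2 sigma r q T : R).
Implicit Types (u Y : R * R -> R).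

Definition psi2 (x : R) : R := Num.max (K2 - expR x) 0 + k2 - K1.

Definition domQ : set (R * R) := `]ln k2, +oo[ `*` `]0, T].

Definition domQ_int : set (R * R) := `]ln k2, +oo[ `*` `]0, T[.

Definition domQ_cl : set (R * R) := `[ln k2, +oo[ `*` `[0, T].

Definition truncQ (S rho : R) : set (R * R) :=
  ((`]ln k2, +oo[ `&` `]- S, S[) `*` `]0, T[) `\` disc (ln K2, 0) rho.

(* [u] belongs to W_p(Q) and its weak derivatives are [ux], [uxx], [ut].  Every
   compact subset of [domQ_int] lies in some [truncQ S rho], so requiring the
   weak derivatives in the whole of [domQ_int] is the same as requiring them in
   each truncated region. *)
Definition in_Wp (p : R) u (ux uxx ut : R * R -> R) : Prop :=
  [/\ {within domQ_cl, continuous u},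
      weak_derivative domQ_int 1 0 u ux,
      weak_derivative domQ_int 2 0 u uxx,
      weak_derivative domQ_int 0 1 u ut &
      forall S rho, 0 < S -> 0 < rho ->
        [/\ Lp_on p (truncQ S rho) u, Lp_on p (truncQ S rho) ux,
            Lp_on p (truncQ S rho) uxx & Lp_on p (truncQ S rho) ut]].

(* The value of L u where [u], [u_x], [u_xx] take the values [v], [vx], [vxx]. *)
Definition opL (v vx vxx : R) : R :=
  sigma ^+ 2 / 2 * vxx + (r - q - sigma ^+ 2 / 2) * vx - r * v.

Definition strong_solution (p : R) Y : Prop :=
  exists Yx Yxx Yt : R * R -> R,
  [/\ in_Wp p Y Yx Yxx Yt,
      forall z, domQ z -> psi2 z.1 <= Y z,
      {ae leb2, forall z, domQ z ->
         0 <= Yt z - opL (Y z) (Yx z) (Yxx z)},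
      {ae leb2, forall z, domQ z -> psi2 z.1 < Y z ->
         Yt z - opL (Y z) (Yx z) (Yxx z) = 0} &
      (forall x, ln k2 < x -> Y (x, 0) = psi2 x) /\
      (forall tau, 0 <= tau <= T -> Y (ln k2, tau) = K2 - K1)].

Definition bounded_on_Q Y : Prop :=
  exists M : R, forall z, domQ_cl z -> `|Y z| <= M.

Definition contact_set Y (tau : R) : set R :=
  [set x | ln K2 <= x /\ Y (x, tau) = k2 - K1].

Definition outer_free_boundary Y (A : R -> R) : Prop :=
  forall tau, 0 < tau <= T ->
    contact_set Y tau (A tau) /\ lbound (contact_set Y tau) (A tau).

End PutSideObstacleProblem.

Definition extend_at0 {R : realType} (A : R -> R) : R -> R :=
  fun tau => if tau == 0 then lim (A s @[s --> 0^'+]) else A tau.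

(* Main.v *)
(* Only the weak formulation of the equation matters.  Mollification shows that
   -Y is locally a uniform limit of classical subsolutions of
   u_t - D u_xx - be u_x + r u <= 0 (D = sigma^2/2, be = r - q - D), and that Y
   itself is one wherever Y > psi2.  Such limits satisfy a touching principle
   and hence a maximum principle, and everything else is comparison.

   Comparing Y with its time shifts gives monotonicity in time, so contact sets
   shrink; as the constant c = k2 - K1 is a strict supersolution, contact at
   (x0, t0) with x0 >= ln K2 spreads to all of [x0, oo) x [0, t0].  A small
   parabola c + k (x - x1)^2 is a supersolution too, so contact on a
   neighbourhood of x1 persists for a short time: this yields right continuity
   and the limit ln K2 at 0.  Left continuity is closedness of the contact set.

   Strictness: if A were constant = x0 on [s, t], the increment
   W = Y(., . + h) - Y would be positive somewhere below the boundary (A does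
   move before s), stay positive in time, and by a Hopf barrier be at least
   k (x0 - x) near x0.  Then Y would have a convex kink along the boundary,
   which a supersolution cannot have.  The kink of psi2 at ln K2 excludes
   A = ln K2 in the same way. *)
Require Import Defs.
From mathcomp Require Import all_boot all_order all_algebra.
From mathcomp Require Import all_classical all_reals all_analysis.
From mathcomp Require Import measurable_realfun ring lra.
Import Order.TTheory GRing.Theory Num.Theory.
Import numFieldNormedType.Exports.
Local Open Scope classical_set_scope.
Local Open Scope ring_scope.

Set Implicit Arguments.
Unset Strict Implicit.
Unset Printing Implicit Defensive.

(** * A compactly supported smooth function *)

Section Bump.
Context {R : realType}.
Implicit Types (f g : R -> R) (n k : nat).

Fixpoint CkR n f : Prop :=
  if n is m.+1 then
    exists2 f', (forall x, is_derive x (1 : R) f (f' x)) & CkR m f'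
  else continuous f.

Lemma is_derive_continuous f f' :
  (forall x, is_derive x (1 : R) f (f' x)) -> continuous f.
Proof.
move=> df x; apply: differentiable_continuous.
by apply/derivable1_diffP; apply: ex_derive.
Qed.

Lemma CkR_continuous n f : CkR n f -> continuous f.
Proof. by case: n => [//|n] /= [f' /is_derive_continuous]. Qed.

Lemma CkR_pred n f : CkR n.+1 f -> CkR n f.
Proof.
elim: n f => [|n IHn] f [f' df Cf']; first exact: is_derive_continuous df.
by exists f' => //; exact: IHn.
Qed.

Lemma CkR_cst n (c : R) : CkR n (fun=> c).
Proof.
elim: n c => [|n IHn] c /=; first by move=> x; exact: cvg_cst.
by exists (fun=> 0) => // x; exact: is_derive_cst.
Qed.

Lemma CkRD n f g : CkR n f -> CkR n g -> CkR n (fun x => f x + g x).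
Proof.
elim: n f g => [|n IHn] f g /=.
  by move=> cf cg x; apply: (@cvgD _ R^o); [exact: cf|exact: cg].
move=> [f' df Cf] [g' dg Cg]; exists (fun x => f' x + g' x); last exact: IHn.
by move=> x; exact: is_deriveD.
Qed.

Lemma CkRM n f g : CkR n f -> CkR n g -> CkR n (fun x => f x * g x).
Proof.
elim: n f g => [|n IHn] f g.
  by move=> cf cg x; apply: cvgM; [exact: cf|exact: cg].
move=> Cf Cg; have [f' df Cf'] := Cf; have [g' dg Cg'] := Cg.
exists (fun x => f x * g' x + g x * f' x).
  by move=> x; exact: is_deriveM.
by apply: CkRD; apply: IHn => //; exact: CkR_pred.
Qed.

Lemma is_derive_affine f (a b x df : R) :
  is_derive (a * x + b) (1 : R) f df ->
  is_derive x (1 : R) (fun s => f (a * s + b)) (a * df).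
Proof.
move=> dfx; have dg : is_derive x (1 : R) (fun s => a * s + b) a.
  by apply: is_derive_eq; rewrite addr0 [LHS]mulr1.
rewrite mulrC; exact: (@is_derive1_comp _ f _ x df a).
Qed.

Lemma CkR_affine n f (a b : R) : CkR n f -> CkR n (fun s => f (a * s + b)).
Proof.
elim: n f => [|n IHn] f /=.
  move=> cf x; apply: (@continuous_comp _ _ _ (fun s => a * s + b) f); last exact: cf.
  by apply: (@cvgD _ R^o); [apply: (@cvgM R); [exact: cvg_cst|exact: cvg_id]|exact: cvg_cst].
move=> [f' df Cf]; exists (fun s => a * f' (a * s + b)).
  by move=> x; exact: is_derive_affine.
by apply: CkRM; [exact: CkR_cst|exact: IHn].
Qed.

(* The class of the [flat k] is closed under differentiation up to linear
   combinations; [flat 0] is the usual exp(-1/s). *)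
Definition flat k (s : R) : R := if 0 < s then s^-1 ^+ k * expR (- s^-1) else 0.

Lemma flat_ge0 k s : 0 <= flat k s.
Proof.
rewrite /flat; case: ifPn => // s0.
by rewrite mulr_ge0 ?expR_ge0 ?exprn_ge0// invr_ge0 ltW.
Qed.

(** With u = 1/s this is u^(k+2) <= (k+2)! exp(u), which keeps one term of the exponential series.
    The two powers beyond those in [flat k] leave the factor s^2 that forces derivative 0 at the
    origin. *)
Lemma flat_le k s : flat k s <= (k.+2)`!%:R * s ^+ 2.
Proof.
rewrite /flat; case: ifPn => [s0|_]; last by rewrite mulr_ge0// sqr_ge0.
have u0 : 0 < s^-1 by rewrite invr_gt0.
have := expR_ge1Dxn k.+1 (ltW u0).
set u := s^-1 in u0 *; set c : R := _%:R => H.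
have c0 : 0 < c by rewrite ltr0n fact_gt0.
have {}H : u ^+ k.+2 <= c * expR u.
  by rewrite -ler_pdivrMl// mulrC; apply: le_trans H; rewrite lerDr.
have -> : s = u^-1 by rewrite invrK.
have -> : u^-1 ^+ 2 = (u ^+ 2)^-1 by rewrite exprVn.
by rewrite expRN ler_pdivrMr ?expR_gt0// mulrAC ler_pdivlMr ?exprn_gt0// -exprD addn2.
Qed.

Lemma is_derive0_quadratic f (C : R) :
  (forall s, `|f s| <= C * s ^+ 2) -> is_derive 0 (1 : R) f 0.
Proof.
move=> fC.
have f0 : f 0 = 0 by apply/eqP; rewrite -normr_le0 (le_trans (fC 0))// expr0n mulr0.
have C0 : 0 <= C by have := fC 1; rewrite expr1n mulr1; exact: le_trans.
have H : (fun h : R => h^-1 *: ((f \o shift 0) (h *: 1) - f 0)) @ 0^' --> (0 : R).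
  apply/cvgrPdist_le => e e0; near=> h.
  have h0 : h != 0 by near: h; exact: nbhs_dnbhs_neq.
  rewrite sub0r normrN /= addr0 f0 subr0 normrZ normfV [h%:A]mulr1.
  rewrite ler_pdivrMl ?normr_gt0//; apply: le_trans (fC h) _.
  rewrite -real_normK ?num_real// expr2 mulrCA ler_wpM2l//.
  (* [C] may be 0, hence the divisor [C + 1]. *)
  have : `|h| <= e / (C + 1).
    near: h; apply: dnbhs0_le; rewrite divr_gt0//; lra.
  rewrite ler_pdivlMr; last lra.
  move=> H; apply: le_trans H; rewrite mulrC ler_wpM2l//; lra.
apply: DeriveDef; first by apply/cvg_ex; exists 0.
exact/cvg_lim.
Unshelve. all: by end_near. Qed.

Lemma is_derive_flat k s :
  is_derive s (1 : R) (flat k) (flat k.+2 s - k%:R * flat k.+1 s).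
Proof.
have [s0|s0|s0] := ltgtP s 0.
- rewrite {2 3}/flat ltNge (ltW s0) /= mulr0 subr0.
  apply: (@near_eq_is_derive _ _ _ (fun=> 0 : R) (flat k) s 1 0).
    near=> t; rewrite /flat ifF//; apply/negbTE; rewrite -leNgt ltW//.
    by near: t; apply: lt_nbhsl.
- rewrite {2 3}/flat s0.
  apply: (@near_eq_is_derive _ _ _ (fun t : R => t^-1 ^+ k * expR (- t^-1)) (flat k) s 1).
    near=> t; rewrite /flat ifT//.
    by near: t; apply: lt_nbhsr.
  have sN0 : s != 0 by rewrite gt_eqF.
  have dV : is_derive s (1 : R) (fun t : R => t^-1) (- s^-1 ^+ 2).
    apply: is_derive_eq; first exact: (is_deriveV sN0 (is_derive_id _ _)).
    by rewrite [LHS]mulr1 exprVn.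
  have dE : is_derive s (1 : R) (fun t : R => expR (- t^-1)) (expR (- s^-1) * s^-1 ^+ 2).
    apply: (@is_derive1_comp _ expR (fun t : R => - t^-1)).
    by rewrite -[X in is_derive _ _ _ X]opprK; apply: is_deriveN.
  have dX := is_deriveX k dV.
  have -> : (fun t : R => t^-1 ^+ k * expR (- t^-1)) =
            ((fun t : R => t^-1) ^+ k) * (fun t : R => expR (- t^-1)).
    by apply/funext => t; rewrite /= fctE exprfctE.
  apply: is_derive_eq; rewrite /GRing.scale /= exprfctE.
  case: (k) => [|m]; first by rewrite mulr0n; ring.
  by rewrite /= !exprS -mulr_natl; ring.
- rewrite s0 {2 3}/flat !ltxx mulr0 subr0.
  apply: (@is_derive0_quadratic _ (k.+2)`!%:R) => t.
  by rewrite ger0_norm ?flat_ge0// flat_le.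
Unshelve. all: by end_near. Qed.

Lemma CkR_flat n k : CkR n (flat k).
Proof.
elim: n k => [|n IHn] k.
  apply: is_derive_continuous => s; exact: is_derive_flat.
exists (fun s => flat k.+2 s - k%:R * flat k.+1 s); first exact: is_derive_flat.
apply: CkRD => //.
have -> : (fun x => - (k%:R * flat k.+1 x)) = fun x => (- k%:R) * flat k.+1 x.
  by apply/funext => x; rewrite mulNr.
by apply: CkRM => //; exact: CkR_cst.
Qed.

Lemma CkR_derive1 n f : CkR n.+1 f -> CkR n (derive1 f).
Proof.
move=> [f' df Cf']; suff -> : derive1 f = f' by [].
by apply/funext => x; rewrite derive1E derive_val.
Qed.

Lemma CkR_is_derive n f x : CkR n.+1 f -> is_derive x (1 : R) f (derive1 f x).
Proof.
by move=> [f' df _]; rewrite derive1E; apply: derivableP; apply: ex_derive.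
Qed.

(* Here [y] is the integration variable and [(x, t)] the point at which the
   mollification is evaluated. *)
Definition tensor (a b : R -> R) (x t : R) : R * R -> R :=
  fun y => a (y.1 - x) * b (y.2 - t).

(** Reduces a directional derivative in the plane to a derivative along a line, where the
    one-variable rules apply. *)
Lemma is_derive_line (F : R * R -> R) (y v : R * R) (d : R) :
  is_derive (0 : R) (1 : R) (fun h : R => F (h *: v + y)) d -> is_derive y v F d.
Proof.
move=> [D1 D2]; apply: DeriveDef; first exact/derivable1P.
rewrite -D2 /derive; set f1 := (X in lim (X @ _) = _); set f2 := (X in _ = lim (X @ _)).
suff -> : f1 = f2 by [].
apply/funext => h; rewrite /f1 /f2 /=.
by rewrite addr0 [h%:A]mulr1 scale0r add0r.
Qed.

Lemma is_derive_tensor1 (a b : R -> R) x t (y : R * R) da :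
  is_derive (y.1 - x) (1 : R) a da ->
  is_derive y ((1, 0) : R * R) (tensor a b x t) (da * b (y.2 - t)).
Proof.
move=> ada.
have E : (fun h : R => (tensor a b x t) (h *: (1, 0) + y)) =
         (fun h : R => a (1 * h + (y.1 - x)) * b (y.2 - t)).
  apply/funext => h; rewrite /tensor /= scaler0 add0r.
  by congr (a _ * _); rewrite [h%:A]mulr1 mul1r addrA.
have D : is_derive (0 : R) (1 : R) (fun h : R => (tensor a b x t) (h *: (1, 0) + y))
    (da * b (y.2 - t)).
  rewrite E; apply: is_derive_eq.
    apply: (is_deriveM (is_derive_affine _) (is_derive_cst _ _ _)).
    by rewrite mulr0 add0r; exact: ada.
  by rewrite scaler0 add0r mul1r [LHS]mulrC.
exact/is_derive_line.
Qed.

Lemma is_derive_tensor2 (a b : R -> R) x t (y : R * R) db :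
  is_derive (y.2 - t) (1 : R) b db ->
  is_derive y ((0, 1) : R * R) (tensor a b x t) (a (y.1 - x) * db).
Proof.
move=> bdb.
have E : (fun h : R => (tensor a b x t) (h *: (0, 1) + y)) =
         (fun h : R => a (y.1 - x) * b (1 * h + (y.2 - t))).
  apply/funext => h; rewrite /tensor /= scaler0 add0r.
  by congr (_ * b _); rewrite [h%:A]mulr1 mul1r addrA.
have D : is_derive (0 : R) (1 : R) (fun h : R => (tensor a b x t) (h *: (0, 1) + y))
    (a (y.1 - x) * db).
  rewrite E; apply: is_derive_eq.
    apply: (is_deriveM (is_derive_cst _ _ _) (is_derive_affine _)).
    by rewrite mulr0 add0r; exact: bdb.
  by rewrite scaler0 addr0 mul1r.
exact/is_derive_line.
Qed.

Lemma dx_tensor (a b : R -> R) x t : CkR 1 a ->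
  dx (tensor a b x t) = tensor (derive1 a) b x t.
Proof.
move=> Ca; apply/funext => y; rewrite /dx.
by have [_ ->] := is_derive_tensor1 b t (CkR_is_derive (y.1 - x) Ca).
Qed.

Lemma dtau_tensor (a b : R -> R) x t : CkR 1 b ->
  dtau (tensor a b x t) = tensor a (derive1 b) x t.
Proof.
move=> Cb; apply/funext => y; rewrite /dtau.
by have [_ ->] := is_derive_tensor2 a x (CkR_is_derive (y.2 - t) Cb).
Qed.

Lemma continuous_tensor (a b : R -> R) x t :
  continuous a -> continuous b -> continuous (tensor a b x t).
Proof.
move=> ca cb y; apply: cvgM.
- apply: (@continuous_comp _ _ _ (fun y : R * R => y.1 - x) a); last exact: ca.
  by apply: (@cvgB _ R^o); [exact: cvg_fst|exact: cvg_cst].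
- apply: (@continuous_comp _ _ _ (fun y : R * R => y.2 - t) b); last exact: cb.
  by apply: (@cvgB _ R^o); [exact: cvg_snd|exact: cvg_cst].
Qed.

Lemma Ck_tensor n (a b : R -> R) x t :
  CkR n a -> CkR n b -> Ck n (tensor a b x t).
Proof.
elim: n a b => [|n IHn] a b Ca Cb.
  by split => //; exact: continuous_tensor.
split.
  by apply: continuous_tensor; [exact: CkR_continuous Ca|exact: CkR_continuous Cb].
have Ca1 : CkR 1 a by case: Ca => a' da /CkR_continuous ca'; exists a'.
have Cb1 : CkR 1 b by case: Cb => b' db /CkR_continuous cb'; exists b'.
split => [z|z||].
- by apply: ex_derive; apply: is_derive_tensor1; exact: CkR_is_derive Ca.
- by apply: ex_derive; apply: is_derive_tensor2; exact: CkR_is_derive Cb.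
- by rewrite dx_tensor//; apply: IHn; [exact: CkR_derive1|exact: CkR_pred].
- by rewrite dtau_tensor//; apply: IHn; [exact: CkR_pred|exact: CkR_derive1].
Qed.

Lemma test_function_tensor (Omega : set (R * R)) (a b : R -> R) (e x t : R) :
  (forall n, CkR n a) -> (forall n, CkR n b) ->
  (forall s, e < `|s| -> a s = 0) -> (forall s, e < `|s| -> b s = 0) ->
  `[x - e, x + e] `*` `[t - e, t + e] `<=` Omega ->
  test_function Omega (tensor a b x t).
Proof.
move=> Ca Cb a0 b0 subO; split; first by move=> n; exact: Ck_tensor.
exists (`[x - e, x + e] `*` `[t - e, t + e]); split => //.
  by apply: compact_setX; exact: segment_compact.
move=> y; rewrite /tensor => /not_andP[]; rewrite /= in_itv/= => /negP H.
  by rewrite a0 ?mul0r// ltNge; apply: contra H; rewrite ler_norml; lra.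
by rewrite b0 ?mulr0// ltNge; apply: contra H; rewrite ler_norml; lra.
Qed.

(** For |s| < e this is exp(-2 / (1 - (s/e)^2)), the standard bump. It is left unnormalised; its
    integral is divided out later. *)
Definition mollifier (e s : R) : R := flat 0 (e^-1 * s + 1) * flat 0 (- e^-1 * s + 1).

Lemma CkR_mollifier n e : CkR n (mollifier e).
Proof. by apply: CkRM; apply: CkR_affine; exact: CkR_flat. Qed.

Lemma mollifier_ge0 e s : 0 <= mollifier e s.
Proof. by rewrite mulr_ge0// flat_ge0. Qed.

Lemma mollifier0_gt0 e : 0 < mollifier e 0.
Proof.
by rewrite /mollifier !mulr0 add0r /flat ltr01 expr0 mul1r mulr_gt0// expR_gt0.
Qed.

Lemma mollifier_eq0 e s : 0 < e -> e <= `|s| -> mollifier e s = 0.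
Proof.
move=> e0; rewrite /mollifier ler_normr => /orP[es|es].
  rewrite [X in _ * X]/flat ifF ?mulr0//; apply/negbTE; rewrite -leNgt.
  have : 1 <= e^-1 * s by rewrite ler_pdivlMl// mulr1.
  lra.
rewrite [X in X * _]/flat ifF ?mul0r//; apply/negbTE; rewrite -leNgt.
have : 1 <= e^-1 * - s by rewrite ler_pdivlMl// mulr1.
lra.
Qed.

Lemma mollifier_derive1_eq0 e s : 0 < e -> e < `|s| -> (derive1 (mollifier e)) s = 0.
Proof.
move=> e0 es; rewrite derive1E.
have [|_ ->//] := @near_eq_is_derive _ _ _ (fun=> 0 : R) (mollifier e) s 1 0.
near=> u; rewrite mollifier_eq0//; apply/ltW.
near: u; move: (@norm_continuous _ R^o s) => /cvgr_gt; exact.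
Unshelve. all: by end_near. Qed.

Lemma mollifier_derive2_eq0 e s : 0 < e -> e < `|s| -> derive1 (derive1 (mollifier e)) s = 0.
Proof.
move=> e0 es; rewrite derive1E.
have [|_ ->//] := @near_eq_is_derive _ _ _ (fun=> 0 : R) (derive1 (mollifier e)) s 1 0.
near=> u; rewrite mollifier_derive1_eq0//.
near: u; move: (@norm_continuous _ R^o s) => /cvgr_gt; exact.
Unshelve. all: by end_near. Qed.

End Bump.

(** * Convolution over a box *)

Section Convolution.
Context {R : realType}.
Local Notation mR := (measurableTypeR R).
Implicit Types (f : R * R -> R) (a b : R -> R) (K : set (R * R)).

Lemma is_derive_cM a (c d x : R) :
  is_derive x (1 : R) a d -> is_derive x (1 : R) (fun s => c * a s) (c * d).
Proof. by move=> ad; exact: (is_deriveZ c ad). Qed.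

Lemma measurable_box (x1 x2 t1 t2 : R) :
  measurable (`[x1, x2] `*` `[t1, t2] : set (mR * mR)).
Proof. by apply: measurableX; exact: measurable_itv. Qed.

Lemma measurable_tensor a b x t : continuous a -> continuous b ->
  measurable_fun [set: mR * mR] (tensor a b x t : mR * mR -> mR).
Proof.
move=> ca cb; apply: measurable_funM.
- apply: (measurableT_comp (f := a : mR -> mR)); first exact: continuous_measurable_fun.
  by apply: measurable_funB => //; exact: measurable_fst.
- apply: (measurableT_comp (f := b : mR -> mR)); first exact: continuous_measurable_fun.
  by apply: measurable_funB => //; exact: measurable_snd.
Qed.

Lemma continuous_bounded_support a (e : R) : continuous a ->
  (forall s, e < `|s| -> a s = 0) -> exists2 M, 0 <= M & forall s, `|a s| <= M.
Proof.
move=> ca a0; have [e0|e0] := ltP e 0.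
  exists 0 => // s; rewrite a0 ?normr0//; exact: lt_le_trans e0 (normr_ge0 _).
have eNe : - e <= e by lra.
have [|c _ cmax] := @EVT_max R (fun s => `|a s|) (- e) e eNe.
  apply: continuous_subspaceT => s.
  apply: (@continuous_comp _ _ _ a Num.norm); [exact: ca|exact: norm_continuous].
exists `|a c| => // s; have [es|es] := ltP e `|s|; first by rewrite a0 ?normr0.
by apply: cmax; rewrite in_itv/= -ler_norml.
Qed.

Lemma integrable_tensor K f a b (Ma Mb x t : R) :
  measurable (K : set (mR * mR)) -> leb2.-integrable K (EFin \o f) ->
  continuous a -> continuous b ->
  (forall s, `|a s| <= Ma) -> (forall s, `|b s| <= Mb) ->
  leb2.-integrable K (EFin \o (fun y => f y * tensor a b x t y)).
Proof.
move=> mK intf ca cb aM bM.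
have -> : EFin \o (fun y => f y * tensor a b x t y) =
   ((EFin \o f) \* (EFin \o tensor a b x t))%E by [].
apply: integrableMl => //.
  by apply: measurable_funS (measurable_tensor x t ca cb).
exists (Ma * Mb); split; first exact: num_real.
move=> M MM y _ /=; rewrite normrM (le_trans _ (ltW MM))//.
by apply: ler_pM.
Qed.

(** Integrating over a fixed set [K] on which [f] is integrable makes this smooth at every point of
    the plane. It is a genuine mollification of [f] only where the support of the kernel lies in
    [K]. *)
Definition conv K f a b (x t : R) : R := \int[leb2]_(y in K) (f y * tensor a b x t y).

Definition mass K f : R := \int[leb2]_(y in K) `|f y|.

Lemma conv_le K f a b (Ma Mb x t : R) :
  measurable (K : set (mR * mR)) -> leb2.-integrable K (EFin \o f) ->
  continuous a -> continuous b ->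
  (forall s, `|a s| <= Ma) -> (forall s, `|b s| <= Mb) ->
  `|conv K f a b x t| <= Ma * Mb * mass K f.
Proof.
move=> mK intf ca cb aM bM.
have intT := integrable_tensor x t mK intf ca cb aM bM.
apply: le_trans (le_normr_Rintegral mK intT) _.
rewrite /mass -RintegralZl//; last exact: integrable_norm intf.
apply: le_Rintegral => //.
- exact: integrable_norm intT.
- have -> : EFin \o (fun y => Ma * Mb * `|f y|) =
    (fun y => (Ma * Mb)%:E * (`|(EFin \o f) y|))%E by [].
  by apply: integrableZl => //; exact: integrable_norm intf.
- move=> y _; rewrite normrM mulrC ler_wpM2r// normrM.
  by apply: ler_pM.
Qed.

Lemma conv_derive1 K f a b (Ma Ma' Mb x t : R) :
  measurable (K : set (mR * mR)) -> leb2.-integrable K (EFin \o f) ->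
  CkR 2 a -> continuous b ->
  (forall s, `|a s| <= Ma) -> (forall s, `|derive1 a s| <= Ma') ->
  (forall s, `|b s| <= Mb) ->
  is_derive x (1 : R) (fun x => conv K f a b x t) (- conv K f (derive1 a) b x t).
Proof.
move=> mK intf Ca cb aM a'M bM.
have ca := CkR_continuous Ca.
have ca' := CkR_continuous (CkR_derive1 Ca).
have D y s : is_derive s (1 : R) (fun x => f y * tensor a b x t y)
    (- (f y * tensor (derive1 a) b s t y)).
  have H : is_derive (-1 * s + y.1) (1 : R) a (derive1 a (-1 * s + y.1)).
    exact: CkR_is_derive Ca.
  have -> : (fun x => f y * tensor a b x t y) =
     (fun x => (f y * b (y.2 - t)) * a (-1 * x + y.1)).
    by apply/funext => u; rewrite /tensor mulN1r [- u + _]addrC; ring.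
  have {}H := is_derive_affine H.
  rewrite (_ : - (_ * _) = (f y * b (y.2 - t)) * (-1 * derive1 a (-1 * s + y.1))).
    exact: is_derive_cM.
  rewrite /tensor !mulN1r [- s + _]addrC; ring.
(* The dominating function is uniform in the parameter, so any open interval around [x] serves. *)
have aI : `]x - 1, x + 1[%classic x by rewrite /= in_itv/=; lra.
have P1 s y : partial1of2 (fun x y => f y * tensor a b x t y) s y =
   - (f y * tensor (derive1 a) b s t y).
  by rewrite /partial1of2 derive1E derive_val.
have int1 s : `]x - 1, x + 1[%classic s ->
    leb2.-integrable K (EFin \o (fun y => f y * tensor a b s t y)).
  by move=> _; exact: integrable_tensor aM bM.
have Ma'0 : 0 <= Ma' by exact: le_trans (a'M 0).
have Mb0 : 0 <= Mb by exact: le_trans (bM 0).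
have G0 (y : mR * mR) : 0 <= Ma' * Mb * `|f y|.
  by rewrite !mulr_ge0.
have intG : leb2.-integrable K (EFin \o (fun y => Ma' * Mb * `|f y|)).
  have -> : EFin \o (fun y => Ma' * Mb * `|f y|) =
    (fun y => (Ma' * Mb)%:E * (`|(EFin \o f) y|))%E by [].
  by apply: integrableZl => //; exact: integrable_norm intf.
have der1 s (y : mR * mR) : `]x - 1, x + 1[%classic s -> K y ->
   derivable (fun x => f y * tensor a b x t y) s 1.
  by move=> _ _; apply: ex_derive.
have Gub s (y : mR * mR) : `]x - 1, x + 1[%classic s -> K y ->
   `|partial1of2 (fun x y => f y * tensor a b x t y) s y| <= Ma' * Mb * `|f y|.
  move=> _ _; rewrite P1 normrN normrM mulrC ler_wpM2r// normrM.
  by apply: ler_pM.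
have HD := @derivable_under_integral R _ _ leb2 _ K mK x _ _ aI int1 der1 _ G0 intG Gub.
have HE := @differentiation_under_integral R _ _ leb2 _ K mK x _ _ aI int1 der1 _ G0 intG Gub.
apply: DeriveDef; first exact: HD.
rewrite -derive1E.
rewrite [LHS]HE /conv.
under eq_Rintegral do rewrite P1 -mulN1r.
by rewrite RintegralZl ?mulN1r//; exact: integrable_tensor a'M bM.
Qed.

Lemma conv_derive2 K f a b (Ma Mb Mb' x t : R) :
  measurable (K : set (mR * mR)) -> leb2.-integrable K (EFin \o f) ->
  continuous a -> CkR 2 b ->
  (forall s, `|a s| <= Ma) ->
  (forall s, `|b s| <= Mb) -> (forall s, `|derive1 b s| <= Mb') ->
  is_derive t (1 : R) (conv K f a b x) (- conv K f a (derive1 b) x t).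
Proof.
move=> mK intf ca Cb aM bM b'M.
have cb := CkR_continuous Cb.
have cb' := CkR_continuous (CkR_derive1 Cb).
have D y s : is_derive s (1 : R) (fun t => f y * tensor a b x t y)
    (- (f y * tensor a (derive1 b) x s y)).
  have H : is_derive (-1 * s + y.2) (1 : R) b (derive1 b (-1 * s + y.2)).
    exact: CkR_is_derive Cb.
  have -> : (fun t => f y * tensor a b x t y) =
     (fun t => (f y * a (y.1 - x)) * b (-1 * t + y.2)).
    by apply/funext => u; rewrite /tensor mulN1r [- u + _]addrC; ring.
  have {}H := is_derive_affine H.
  rewrite (_ : - (_ * _) = (f y * a (y.1 - x)) * (-1 * derive1 b (-1 * s + y.2))).
    exact: is_derive_cM.
  rewrite /tensor !mulN1r [- s + _]addrC; ring.
have aI : `]t - 1, t + 1[%classic t by rewrite /= in_itv/=; lra.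
have P1 s y : partial1of2 (fun t y => f y * tensor a b x t y) s y =
   - (f y * tensor a (derive1 b) x s y).
  by rewrite /partial1of2 derive1E derive_val.
have int1 s : `]t - 1, t + 1[%classic s ->
    leb2.-integrable K (EFin \o (fun y => f y * tensor a b x s y)).
  by move=> _; exact: integrable_tensor aM bM.
have Ma0 : 0 <= Ma by exact: le_trans (aM 0).
have Mb'0 : 0 <= Mb' by exact: le_trans (b'M 0).
have G0 (y : mR * mR) : 0 <= Ma * Mb' * `|f y|.
  by rewrite !mulr_ge0.
have intG : leb2.-integrable K (EFin \o (fun y => Ma * Mb' * `|f y|)).
  have -> : EFin \o (fun y => Ma * Mb' * `|f y|) =
    (fun y => (Ma * Mb')%:E * (`|(EFin \o f) y|))%E by [].
  by apply: integrableZl => //; exact: integrable_norm intf.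
have der1 s (y : mR * mR) : `]t - 1, t + 1[%classic s -> K y ->
   derivable (fun t => f y * tensor a b x t y) s 1.
  by move=> _ _; apply: ex_derive.
have Gub s (y : mR * mR) : `]t - 1, t + 1[%classic s -> K y ->
   `|partial1of2 (fun t y => f y * tensor a b x t y) s y| <= Ma * Mb' * `|f y|.
  move=> _ _; rewrite P1 normrN normrM mulrC ler_wpM2r// normrM.
  by apply: ler_pM.
have HD := @derivable_under_integral R _ _ leb2 _ K mK t _ _ aI int1 der1 _ G0 intG Gub.
have HE := @differentiation_under_integral R _ _ leb2 _ K mK t _ _ aI int1 der1 _ G0 intG Gub.
apply: DeriveDef; first exact: HD.
rewrite -derive1E.
rewrite [LHS]HE /conv.
under eq_Rintegral do rewrite P1 -mulN1r.
by rewrite RintegralZl ?mulN1r//; exact: integrable_tensor aM b'M.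
Qed.

Lemma derive_bounded_lipschitz (f f' : R -> R) (C x y : R) :
  (forall s, is_derive s (1 : R) f (f' s)) -> (forall s, `|f' s| <= C) ->
  `|f x - f y| <= C * `|x - y|.
Proof.
move=> df f'C; wlog xy : x y / x <= y.
  move=> H; have [/H//|/ltW/H] := leP x y.
  by rewrite distrC (distrC x).
have cf : {within `[x, y], continuous f}.
  by apply: continuous_subspaceT; exact: is_derive_continuous df.
have [c _ E] := @MVT_segment R f f' x y xy (fun s _ => df s) cf.
by rewrite distrC E normrM (distrC x) ler_wpM2r.
Qed.

(** Both coordinates are changed one axis at a time, and each leg is Lipschitz by the mean value
    theorem. Joint continuity of a mollification thus follows from bounds on its first
    derivatives. *)
Lemma continuous_bounded_partials (V Vx Vt : R -> R -> R) (C : R) :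
  (forall x t, is_derive x (1 : R) (V ^~ t) (Vx x t)) ->
  (forall x t, is_derive t (1 : R) (V x) (Vt x t)) ->
  (forall x t, `|Vx x t| <= C) -> (forall x t, `|Vt x t| <= C) ->
  continuous (fun z : R * R => V z.1 z.2).
Proof.
move=> dVx dVt VxC VtC z; apply/cvgrPdist_le => e e0.
have C0 : 0 <= C by exact: le_trans (VxC 0 0).
have d0 : 0 < e / (2 * C + 1) by rewrite divr_gt0//; lra.
near=> w.
have -> : V z.1 z.2 - V w.1 w.2 =
  (V z.1 z.2 - V w.1 z.2) + (V w.1 z.2 - V w.1 w.2) by ring.
apply: le_trans (ler_normD _ _) _.
have H1 := derive_bounded_lipschitz z.1 w.1 (dVx ^~ z.2) (VxC ^~ z.2).
have H2 := derive_bounded_lipschitz z.2 w.2 (dVt w.1) (VtC w.1).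
have : `|z.1 - w.1| <= e / (2 * C + 1) /\ `|z.2 - w.2| <= e / (2 * C + 1).
  near: w; exists (ball z.1 (e / (2 * C + 1)), ball z.2 (e / (2 * C + 1))).
    by split; exact: nbhsx_ballx.
  by move=> w [/= /ltW ? /ltW ?].
move=> [w1 w2].
have h1 := le_trans H1 (ler_wpM2l C0 w1).
have h2 := le_trans H2 (ler_wpM2l C0 w2).
apply: le_trans (lerD h1 h2) _.
have -> : C * (e / (2 * C + 1)) + C * (e / (2 * C + 1)) = (2 * C) * e / (2 * C + 1).
  by ring.
rewrite ler_pdivrMr; last lra.
rewrite mulrC ler_wpM2l// ?ltW//; lra.
Unshelve. all: by end_near. Qed.

Local Notation mu1 := (@lebesgue_measure R).

Lemma integral_translate a (x : R) : continuous a -> (forall s, 0 <= a s) ->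
  (\int[mu1]_y (a (y - x))%:E = \int[mu1]_y (a y)%:E)%E.
Proof.
move=> ca a0.
have dF : forall s : R, is_derive s (1 : R) (fun y : R => y - x) 1.
  move=> s; exact: is_derive_shift.
have D1 : derive1 (fun y : R => y - x) = cst 1.
  by apply/funext => s; rewrite derive1E derive_val.
rewrite [RHS](@increasing_ge0_integration_by_substitutionT R (fun y => y - x) a) //.
- by apply: eq_integral => y _; rewrite D1 /= fctE mulr1.
- by move=> u v uv; rewrite ltrD2r.
- by rewrite D1; exact: cst_continuous.
- by rewrite D1; exact: is_cvg_cst.
- by rewrite D1; exact: is_cvg_cst.
- by apply: cvg_addrr_Ny.
- by apply: cvg_addrr.
Qed.

Lemma mollifier_integral (e : R) : 0 < e ->
  exists2 N : R, 0 < N & (\int[mu1]_y (mollifier e y)%:E = N%:E)%E.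
Proof.
move=> e0.
have cb : continuous (mollifier e) := CkR_continuous (CkR_mollifier 0 e).
pose J (d : R) : set R := `[- d, d]%classic.
have E : (\int[mu1]_y (mollifier e y)%:E = \int[mu1]_(y in J e) (mollifier e y)%:E)%E.
  rewrite [RHS]integral_mkcond; apply: eq_integral => y _.
  rewrite patchE; case: ifPn => // ny; rewrite mollifier_eq0// leNgt.
  by apply: contra ny; rewrite inE/J/= in_itv/= ltr_norml => /andP[/ltW-> /ltW->].
have mb : measurable_fun setT (mollifier e : mR -> mR) by exact: continuous_measurable_fun.
have I : mu1.-integrable (J e) (EFin \o mollifier e).
  apply: continuous_compact_integrable; first exact: segment_compact.
  exact: continuous_subspaceT.
have F : (\int[mu1]_y (mollifier e y)%:E \is a fin_num)%E.
  by rewrite E; apply: integrable_fin_num => //; exact: measurable_itv.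
exists (fine (\int[mu1]_y (mollifier e y)%:E)); last by rewrite fineK.
(* Positivity of the integral: by continuity, the mollifier stays above half of its value at 0 on a
   short interval. *)
have [d /= d0 bd] : \forall d \near (0 : R)^'+,
    forall y, `|y| <= d -> mollifier e 0 / 2 <= mollifier e y.
  have /cvgrPdist_lt/(_ (mollifier e 0 / 2)) := cb 0.
  rewrite divr_gt0 ?mollifier0_gt0// => /(_ isT) [d /= d0 bd].
  exists d => // s /=; rewrite sub0r normrN => sd s0 y ys.
  have : `|mollifier e 0 - mollifier e y| < mollifier e 0 / 2.
    apply: bd => /=; rewrite sub0r normrN; apply: le_lt_trans ys _.
    by rewrite (le_lt_trans (ler_norm _) sd).
  rewrite ltr_norml; have := mollifier0_gt0 e; lra.
have {bd} bd : forall y, `|y| <= d / 2 -> mollifier e 0 / 2 <= mollifier e y.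
  apply: (bd (d / 2)); rewrite /= ?divr_gt0// sub0r normrN ger0_norm ?divr_ge0 ?ltW//.
  by rewrite ltr_pdivrMr// ltr_pMr// ltr1n.
have : ((mollifier e 0 / 2 * d)%:E <= \int[mu1]_y (mollifier e y)%:E)%E.
  apply: (@le_trans _ _ (\int[mu1]_(y in J (d / 2)%R) (mollifier e y)%:E)%E); last first.
    apply: ge0_subset_integral => //=.
    - exact: measurable_itv.
    - exact/measurable_EFinP.
    - by move=> y _; rewrite lee_fin mollifier_ge0.
  have -> : ((mollifier e 0 / 2 * d)%:E = \int[mu1]_(y in J (d / 2)%R) (mollifier e 0 / 2)%:E)%E.
    rewrite integral_cst; last exact: measurable_itv.
    rewrite [X in (_ * X)%E](lebesgue_measure_itv `[- (d / 2), d / 2]) /= lte_fin ifT; last lra.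
    by rewrite -EFinM; congr EFin; field.
  apply: ge0_le_integral => //=.
  - exact: measurable_itv.
  - by move=> y _; rewrite lee_fin divr_ge0// mollifier_ge0.
  - by apply/measurable_EFinP; exact: measurable_funTS.
  - by move=> y; rewrite /J/= in_itv/= -ler_norml lee_fin => /bd.
rewrite -(fineK F) lee_fin; apply: lt_le_trans.
by rewrite mulr_gt0// divr_gt0// mollifier0_gt0.
Qed.

(** The kernel vanishes outside the small box, so the integral over [K] is one over the plane, where
    Tonelli and translation invariance give the same constant for every centre. *)
Lemma tensor_mollifier_integral (e : R) : 0 < e ->
  exists2 N : R, 0 < N & forall K x t, `[x - e, x + e] `*` `[t - e, t + e] `<=` K ->
    \int[leb2]_(y in K) tensor (mollifier e) (mollifier e) x t y = N.
Proof.
move=> e0; have [N N0 NE] := mollifier_integral e0.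
have cb : continuous (mollifier e) := CkR_continuous (CkR_mollifier 0 e).
exists (N * N); first exact: mulr_gt0.
move=> K x t sK; rewrite Rintegral_mkcond.
have -> : tensor (mollifier e) (mollifier e) x t \_ K = tensor (mollifier e) (mollifier e) x t.
  apply/funext => y; rewrite patchE; case: ifPn => // yK.
  rewrite /tensor; have [h1|h1] := leP e `|y.1 - x|; first by rewrite mollifier_eq0 ?mul0r.
  have [h2|h2] := leP e `|y.2 - t|; first by rewrite [mollifier e (y.2 - t)]mollifier_eq0 ?mulr0.
  exfalso; move/negP: yK; apply; rewrite inE; apply: sK.
  by move: h1 h2; rewrite !ltr_norml /= !in_itv/=; lra.
rewrite /Rintegral /leb2 fubini_tonelli1; last 2 first.
- by apply/measurable_EFinP; exact: measurable_tensor.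
- by move=> y; rewrite lee_fin mulr_ge0// mollifier_ge0.
rewrite /fubini_F /tensor /=.
under eq_integral => u _.
  under eq_integral => v _ do rewrite EFinM.
  rewrite ge0_integralZl_EFin//=; last 3 first.
  - by move=> v _; rewrite lee_fin mollifier_ge0.
  - apply/measurable_EFinP.
    apply: (measurableT_comp (f := mollifier e : mR -> mR)); first exact: continuous_measurable_fun.
    exact: measurable_funB.
  - exact: mollifier_ge0.
  rewrite integral_translate//; last exact: mollifier_ge0.
  rewrite NE muleC.
  over.
rewrite ge0_integralZl_EFin//=; last 3 first.
- by move=> v _; rewrite lee_fin mollifier_ge0.
- apply/measurable_EFinP.
  apply: (measurableT_comp (f := mollifier e : mR -> mR)); first exact: continuous_measurable_fun.
  exact: measurable_funB.
- exact: ltW.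
rewrite integral_translate//; last exact: mollifier_ge0.
by rewrite NE.
Qed.

End Convolution.

(** Only [V] has to be continuous: it is maximised over a compact box, and its derivatives are
    merely evaluated at the maximum point. *)
Definition smooth21 {R : realType} (V Vx Vxx Vt : R -> R -> R) : Prop :=
  [/\ continuous (fun z : R * R => V z.1 z.2),
      forall x t, is_derive x (1 : R) (V ^~ t) (Vx x t),
      forall x t, is_derive x (1 : R) (Vx ^~ t) (Vxx x t) &
      forall x t, is_derive t (1 : R) (V x) (Vt x t)].

(** * Mollification of a weak solution *)

Section Mollification.
Context {R : realType}.
Local Notation mR := (measurableTypeR R).
Implicit Types (f g : R * R -> R) (a b : R -> R) (K Omega : set (R * R)).

Definition box (x0 t0 d : R) : set (R * R) :=
  `[x0 - d, x0 + d] `*` `[t0 - d, t0 + d].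

Lemma boxP (x0 t0 d x t : R) :
  box x0 t0 d (x, t) <-> `|x - x0| <= d /\ `|t - t0| <= d.
Proof. by rewrite /box /= !in_itv/= !ler_norml; lra. Qed.

Lemma box_compact (x0 t0 d : R) : compact (box x0 t0 d).
Proof. by apply: compact_setX; exact: segment_compact. Qed.

(** Heine-Cantor, with the modulus stated coordinatewise to match the square support of the
    kernel. *)
Lemma box_unif_continuous Omega f (x0 t0 d e : R) :
  {in Omega, continuous f} -> box x0 t0 d `<=` Omega -> 0 < e ->
  exists2 rho, 0 < rho & forall y z, box x0 t0 d y -> box x0 t0 d z ->
    `|y.1 - z.1| <= rho -> `|y.2 - z.2| <= rho -> `|f y - f z| <= e.
Proof.
move=> cf sub e0; have /compact_near_coveringP cov := box_compact (x0 := x0) (t0 := t0) (d := d).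
pose P (rho : R) (y : R * R) := box x0 t0 d y -> forall z, box x0 t0 d z ->
    `|y.1 - z.1| <= rho -> `|y.2 - z.2| <= rho -> `|f y - f z| <= e.
have H : \forall rho \near (0 : R)^'+, box x0 t0 d `<=` P rho.
  apply: cov => y Ky.
  have yO : y \in Omega by rewrite inE; exact: sub.
  have /cvgrPdist_le/(_ (e / 2)) := cf y yO.
  rewrite divr_gt0// => /(_ isT) /nbhs_ballP [d1 /= d10 H].
  exists (ball y (d1 / 2), [set rho | rho < d1 / 2]) => /=.
    split; first by apply: nbhsx_ballx; rewrite divr_gt0.
    by apply: nbhs_right_lt; rewrite divr_gt0.
  move=> [w rho] /= [yw rd] Kw z Kz wz1 wz2.
  have -> : f w - f z = (f y - f z) - (f y - f w) by ring.
  apply: le_trans (ler_normB _ _) _.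
  have -> : e = e / 2 + e / 2 by field.
  have d2 : 0 < d1 / 2 by rewrite divr_gt0.
  move: yw => [yw1 yw2]; rewrite /ball/= in yw1 yw2.
  apply: lerD; apply: H => /=.
    split; rewrite /ball/=.
      have -> : y.1 - z.1 = (y.1 - w.1) + (w.1 - z.1) by ring.
      by rewrite (le_lt_trans (ler_normD _ _))//; lra.
    have -> : y.2 - z.2 = (y.2 - w.2) + (w.2 - z.2) by ring.
    by rewrite (le_lt_trans (ler_normD _ _))//; lra.
  by split; rewrite /ball/=; lra.
have [rho [rho0 Hrho]] : exists rho, 0 < rho /\ box x0 t0 d `<=` P rho.
  near (0 : R)^'+ => rho; exists rho; split => //.
  by near: rho.
exists rho => // y z Ky Kz; exact: (Hrho y Ky).
Unshelve. all: by end_near. Qed.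

Lemma Rintegral_support Omega K (h : R * R -> R) : K `<=` Omega ->
  (forall y, ~ K y -> h y = 0) ->
  \int[leb2]_(y in Omega) h y = \int[leb2]_(y in K) h y.
Proof.
move=> sub h0; rewrite Rintegral_mkcond [RHS]Rintegral_mkcond; apply: eq_Rintegral => y _.
rewrite !patchE; case: ifPn => yO; case: ifPn => yK //.
  by rewrite h0// => Ky; move/negP: yK; apply; rewrite inE.
by exfalso; move/negP: yO; apply; rewrite inE; apply: sub; rewrite inE in yK.
Qed.

Lemma integrable_box1 (x1 x2 t1 t2 : R) :
  leb2.-integrable (`[x1, x2] `*` `[t1, t2] : set (mR * mR)) (EFin \o (fun=> 1)).
Proof.
apply/integrableP; split; first exact: measurable_cst.
under eq_integral do rewrite /= normr1.
rewrite integral_cst; last exact: measurable_box.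
rewrite mul1e /leb2 [X in (X < _)%E]product_measure1E; last 2 first.
- exact: measurable_itv.
- exact: measurable_itv.
have H (u v : R) : exists c : R, (@lebesgue_measure R `[u, v]%classic = c%:E)%E.
  rewrite lebesgue_measure_itv /= lte_fin; case: ifPn => _.
    by exists (v - u).
  by exists 0.
have [c1 E1] := H x1 x2; have [c2 E2] := H t1 t2.
by move: E1 E2 => /= -> ->; rewrite -EFinM ltry.
Qed.

Lemma ae_leb2_imply (P Q : R * R -> Prop) : (forall z, P z -> Q z) ->
  {ae leb2, forall z, P z} -> {ae leb2, forall z, Q z}.
Proof.
move=> PQ [N [mN N0 sN]]; exists N; split => // z nQ; apply: sN => Pz.
by apply: nQ; exact: PQ.
Qed.

Lemma ae_ge0_Rintegral K (h : R * R -> R) :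
  measurable (K : set (mR * mR)) -> leb2.-integrable K (EFin \o h) ->
  {ae leb2, forall z, K z -> 0 <= h z} -> 0 <= \int[leb2]_(y in K) h y.
Proof.
move=> mK ih [N [mN N0 sN]].
rewrite /Rintegral (negligible_integral mN mK ih N0).
apply: Rintegral_ge0 => z [Kz nNz]; apply: contrapT => hz; apply: nNz.
by apply: sN => /= /(_ Kz).
Qed.

Lemma mollifier_bounded (rho : R) : 0 < rho ->
  exists M, [/\ forall s, `|mollifier rho s| <= M, forall s, `|derive1 (mollifier rho) s| <= M
    & forall s, `|derive1 (derive1 (mollifier rho)) s| <= M].
Proof.
move=> rho0.
have [|s rs|M0 M00 H0] := @continuous_bounded_support R (mollifier rho) rho.
- exact: CkR_continuous (CkR_mollifier 0 rho).
- by apply: mollifier_eq0 => //; exact: ltW.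
have [|s rs|M1 M10 H1] := @continuous_bounded_support R (derive1 (mollifier rho)) rho.
- exact: CkR_continuous (CkR_derive1 (CkR_mollifier 1 rho)).
- exact: mollifier_derive1_eq0.
have [|s rs|M2 M20 H2] := @continuous_bounded_support R (derive1 (derive1 (mollifier rho))) rho.
- exact: CkR_continuous (CkR_derive1 (CkR_derive1 (CkR_mollifier 2 rho))).
- exact: mollifier_derive2_eq0.
by exists (M0 + M1 + M2); split => s;
  [have := H0 s|have := H1 s|have := H2 s]; lra.
Qed.

(** Taking the kernel as test function turns the operator applied to [V] into a weighted mean of the
    operator applied to [f], so an almost everywhere sign of the latter becomes a pointwise sign of
    the former. The margin between [d] and [d + d] is room for the support of the kernel. *)
Lemma mollify Omega f fx fxx ft (D be r x0 t0 d : R) :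
  {in Omega, continuous f} ->
  weak_derivative Omega 1 0 f fx -> weak_derivative Omega 2 0 f fxx ->
  weak_derivative Omega 0 1 f ft ->
  0 < d -> box x0 t0 (d + d) `<=` Omega ->
  forall e, 0 < e -> exists V Vx Vxx Vt, [/\ smooth21 V Vx Vxx Vt,
    forall x t, `|x - x0| <= d -> `|t - t0| <= d -> `|V x t - f (x, t)| <= e,
    {ae leb2, forall z, box x0 t0 (d + d) z -> 0 <= ft z - D * fxx z - be * fx z + r * f z} ->
      (forall x t, `|x - x0| <= d -> `|t - t0| <= d ->
        0 <= Vt x t - D * Vxx x t - be * Vx x t + r * V x t) &
    {ae leb2, forall z, box x0 t0 (d + d) z -> ft z - D * fxx z - be * fx z + r * f z <= 0} ->
      (forall x t, `|x - x0| <= d -> `|t - t0| <= d ->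
        Vt x t - D * Vxx x t - be * Vx x t + r * V x t <= 0)].
Proof.
move=> cf [lf lfx wx] [_ lfxx wxx] [_ lft wt] d0 sub e e0.
set K := box x0 t0 (d + d) in sub *.
have [rho0 rho00 uc] := box_unif_continuous cf sub e0.
pose rho := Num.min rho0 d.
have rho_gt0 : 0 < rho by rewrite lt_min rho00 d0.
have rho_le : rho <= rho0 by rewrite ge_min lexx.
have rho_d : rho <= d by rewrite ge_min lexx orbT.
pose a := mollifier rho; pose a' := derive1 a; pose a'' := derive1 a'.
have Ca n : CkR n a by exact: CkR_mollifier.
have Ca' n : CkR n a' by exact: CkR_derive1.
have Ca'' n : CkR n a'' by exact: CkR_derive1.
have ca := CkR_continuous (Ca 0); have ca' := CkR_continuous (Ca' 0).
have ca'' := CkR_continuous (Ca'' 0).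
have [M [aM a'M a''M]] := mollifier_bounded rho_gt0.
rewrite -/a -/a' -/a'' in aM a'M a''M.
have mK : measurable (K : set (mR * mR)) by exact: measurable_box.
have cK : compact K by exact: box_compact.
have If : leb2.-integrable K (EFin \o f) by exact: lf.
have Ifx : leb2.-integrable K (EFin \o fx) by exact: lfx.
have Ifxx : leb2.-integrable K (EFin \o fxx) by exact: lfxx.
have Ift : leb2.-integrable K (EFin \o ft) by exact: lft.
have [N N0 NE] := tensor_mollifier_integral rho_gt0.
have Nn0 : N != 0 by rewrite gt_eqF.
(* Each derivative of [a (y.1 - x)] in [x] or of [a (y.2 - t)] in [t] costs a sign, twice for [Vxx].
   The definition of weak derivatives produces the same signs, so they cancel on the inner box. *)
pose V x t := N^-1 * conv K f a a x t.
pose Vx x t := N^-1 * - conv K f a' a x t.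
pose Vxx x t := N^-1 * - - conv K f a'' a x t.
pose Vt x t := N^-1 * - conv K f a a' x t.
have subK x t : `|x - x0| <= d -> `|t - t0| <= d ->
    `[x - rho, x + rho] `*` `[t - rho, t + rho] `<=` K.
  move=> xd td [u v]; rewrite /= !in_itv/= => uv; apply/boxP.
  by move: xd td uv rho_d; rewrite !ler_norml; clear; lra.
have T x t : `|x - x0| <= d -> `|t - t0| <= d -> test_function Omega (tensor a a x t).
  move=> xd td; apply: (test_function_tensor (e := rho)) => //.
  - by move=> s; move/ltW; exact: mollifier_eq0.
  - by move=> s; move/ltW; exact: mollifier_eq0.
  - by apply: subset_trans sub; exact: subK.
have supp h (b b' : R -> R) x t : `|x - x0| <= d -> `|t - t0| <= d ->
    (forall s, rho < `|s| -> b s = 0) -> (forall s, rho < `|s| -> b' s = 0) ->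
    \int[leb2]_(y in Omega) (h y * tensor b b' x t y) = conv K h b b' x t.
  move=> xd td b0 b'0; apply: Rintegral_support => // y nKy.
  rewrite /tensor; have [h1|h1] := ltP rho `|y.1 - x|; first by rewrite b0// mul0r mulr0.
  have [h2|h2] := ltP rho `|y.2 - t|; first by rewrite b'0// !mulr0.
  exfalso; apply: nKy; apply: (subK x t) => //.
  by move: h1 h2; rewrite !ler_norml /= !in_itv/=; clear; lra.
have a0 s : rho < `|s| -> a s = 0 by move/ltW; exact: mollifier_eq0.
have a'0 s : rho < `|s| -> a' s = 0 by exact: mollifier_derive1_eq0.
have a''0 s : rho < `|s| -> a'' s = 0 by exact: mollifier_derive2_eq0.
have ex x t : `|x - x0| <= d -> `|t - t0| <= d -> conv K f a' a x t = - conv K fx a a x t.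
  move=> xd td; rewrite -!supp//.
  have := wx _ (T x t xd td); rewrite /= dx_tensor// => ->.
  by rewrite addn0 expr1 mulN1r.
have exx x t : `|x - x0| <= d -> `|t - t0| <= d -> conv K f a'' a x t = conv K fxx a a x t.
  move=> xd td; rewrite -!supp//.
  have := wxx _ (T x t xd td); rewrite /= !dx_tensor// => ->.
  by rewrite addn0 sqrrN expr1n mul1r.
have et x t : `|x - x0| <= d -> `|t - t0| <= d -> conv K f a a' x t = - conv K ft a a x t.
  move=> xd td; rewrite -!supp//.
  have := wt _ (T x t xd td); rewrite /= dtau_tensor// => ->.
  by rewrite add0n expr1 mulN1r.
pose G z := ft z - D * fxx z - be * fx z + r * f z.
pose Phi x t z := ft z * tensor a a x t z - D * (fxx z * tensor a a x t z)
  - be * (fx z * tensor a a x t z) + r * (f z * tensor a a x t z).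
have IT h x t : leb2.-integrable K (EFin \o h) ->
    leb2.-integrable K (EFin \o (fun y => h y * tensor a a x t y)).
  by move=> Ih; exact: (integrable_tensor x t mK Ih ca ca aM aM).
have IZ (k : R) h : leb2.-integrable K (EFin \o h) ->
    leb2.-integrable K (EFin \o (fun y => k * h y)).
  move=> Ih; have -> : EFin \o (fun y => k * h y) = (fun y => k%:E * (EFin \o h) y)%E by [].
  exact: integrableZl.
have IB h h' : leb2.-integrable K (EFin \o h) -> leb2.-integrable K (EFin \o h') ->
    leb2.-integrable K (EFin \o (fun y => h y - h' y)).
  move=> Ih Ih'; have -> : EFin \o (fun y => h y - h' y) = ((EFin \o h) \- (EFin \o h'))%E by [].
  exact: integrableB.
have ID h h' : leb2.-integrable K (EFin \o h) -> leb2.-integrable K (EFin \o h') ->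
    leb2.-integrable K (EFin \o (fun y => h y + h' y)).
  move=> Ih Ih'; have -> : EFin \o (fun y => h y + h' y) = ((EFin \o h) \+ (EFin \o h'))%E by [].
  exact: integrableD.
have IPhi x t : leb2.-integrable K (EFin \o Phi x t).
  by apply: (ID _ _); [apply: (IB _ _); [apply: (IB _ _)|]|]; rewrite ?IT//;
    do ?[apply: (IZ _ _)]; exact: IT.
have MV x t : `|x - x0| <= d -> `|t - t0| <= d ->
    Vt x t - D * Vxx x t - be * Vx x t + r * V x t = N^-1 * \int[leb2]_(y in K) Phi x t y.
  move=> xd td; rewrite /Phi RintegralD//; last 2 first.
  - by apply: (IB _ _); [apply: (IB _ _); [exact: IT|]|]; apply: (IZ _ _); exact: IT.
  - by apply: (IZ _ _); exact: IT.
  rewrite RintegralB//; last 2 first.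
  - by apply: (IB _ _); [exact: IT|]; apply: (IZ _ _); exact: IT.
  - by apply: (IZ _ _); exact: IT.
  rewrite RintegralB//; last 2 first.
  - exact: IT.
  - by apply: (IZ _ _); exact: IT.
  rewrite !RintegralZl//; do ?exact: IT.
  rewrite /V /Vx /Vxx /Vt ex// exx// et// /conv; ring.
exists V, Vx, Vxx, Vt; split.
- have dVx x t : is_derive x (1 : R) (V ^~ t) (Vx x t).
    by apply: is_derive_cM; exact: (conv_derive1 x t mK If (Ca 2) ca aM a'M aM).
  have dVt x t : is_derive t (1 : R) (V x) (Vt x t).
    by apply: is_derive_cM; exact: (conv_derive2 x t mK If ca (Ca 2) aM aM a'M).
  have B h b b' x t : leb2.-integrable K (EFin \o h) -> continuous b -> continuous b' ->
     (forall s, `|b s| <= M) -> (forall s, `|b' s| <= M) ->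
     `|N^-1 * - conv K h b b' x t| <= N^-1 * (M * M * mass K h).
    move=> Ih cb cb' bM b'M; rewrite normrM normrN ger0_norm ?invr_ge0 ?(ltW N0)//.
    by rewrite ler_wpM2l ?invr_ge0 ?(ltW N0)//; exact: conv_le.
  split => //.
  + apply: (continuous_bounded_partials dVx dVt) => x t; exact: B.
  + move=> x t; apply: is_derive_cM.
    have H := conv_derive1 x t mK If (Ca' 2) ca a'M a''M aM.
    exact: is_deriveN.
- move=> x t xd td.
  have tE := NE K x t (subK x t xd td); rewrite -/a in tE.
  have I1 : leb2.-integrable K (EFin \o tensor a a x t).
    have -> : tensor a a x t = (fun y => 1 * tensor a a x t y).
      by apply/funext => y; rewrite mul1r.
    exact: (IT (fun=> 1) x t (integrable_box1 _ _ _ _)).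
  (* The error is a weighted mean of [f y - f (x, t)] over points within [rho], where uniform
     continuity bounds it by [e]. *)
  have -> : V x t - f (x, t) = N^-1 * \int[leb2]_(y in K) ((f y - f (x, t)) * tensor a a x t y).
    have -> : (fun y => (f y - f (x, t)) * tensor a a x t y) =
       (fun y => f y * tensor a a x t y - f (x, t) * tensor a a x t y).
      by apply/funext => y; rewrite mulrBl.
    rewrite RintegralB//; last 2 first.
    + exact: IT.
    + exact: IZ.
    rewrite RintegralZl// tE /V /conv; field; exact: Nn0.
  have ITf : leb2.-integrable K (EFin \o (fun y => (f y - f (x, t)) * tensor a a x t y)).
    apply: IT; apply: (IB _ _) => //.
    have -> : (fun=> f (x, t)) = (fun y : R * R => f (x, t) * (fun=> 1) y) :> (R * R -> R).
      by apply/funext => y; rewrite mulr1.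
    exact: (IZ (f (x, t)) (fun=> 1) (integrable_box1 _ _ _ _)).
  rewrite normrM ger0_norm ?invr_ge0 ?(ltW N0)// ler_pdivrMl// mulrC.
  apply: le_trans (le_normr_Rintegral mK ITf) _.
  rewrite -[X in _ <= e * X]tE -RintegralZl//.
  apply: le_Rintegral => //.
  + exact: integrable_norm ITf.
  + exact: IZ.
  + move=> y Ky; rewrite normrM [X in _ * X]ger0_norm; last by rewrite mulr_ge0// mollifier_ge0.
    have [h1|h1] := ltP rho `|y.1 - x|; first by rewrite /tensor a0// mul0r !mulr0.
    have [h2|h2] := ltP rho `|y.2 - t|.
      by rewrite /tensor [a (y.2 - t)]a0// !mulr0.
    apply: ler_wpM2r; first by rewrite mulr_ge0// mollifier_ge0.
    apply: uc => //=; last 2 first.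
    * exact: le_trans rho_le.
    * exact: le_trans rho_le.
    by apply/boxP; move: xd td d0; clear; split; lra.
- move=> H x t xd td; rewrite MV//; apply: mulr_ge0; first by rewrite invr_ge0 ltW.
  apply: ae_ge0_Rintegral => //; apply: ae_leb2_imply H => z H Kz.
  have -> : Phi x t z = G z * tensor a a x t z by rewrite /Phi /G; ring.
  by rewrite mulr_ge0//; [exact: H|rewrite mulr_ge0// mollifier_ge0].
- move=> H x t xd td; rewrite MV// pmulr_rle0 ?invr_gt0//.
  rewrite -oppr_ge0 -mulN1r -RintegralZl//.
  apply: ae_ge0_Rintegral => //; first exact: IZ.
  apply: ae_leb2_imply H => z H Kz.
  have -> : -1 * Phi x t z = - G z * tensor a a x t z by rewrite /Phi /G; ring.
  by rewrite mulr_ge0//; [rewrite oppr_ge0; exact: H|rewrite mulr_ge0// mollifier_ge0].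
Qed.

End Mollification.

(** * Touching principle *)

Section PairContinuity.
Context {R : realType}.

Lemma continuous_pairD (f g : R * R -> R) :
  continuous f -> continuous g -> continuous (fun z => f z + g z).
Proof. by move=> cf cg z; apply: (@cvgD _ R^o); [exact: cf|exact: cg]. Qed.

Lemma continuous_pairM (f g : R * R -> R) :
  continuous f -> continuous g -> continuous (fun z => f z * g z).
Proof. by move=> cf cg z; apply: cvgM; [exact: cf|exact: cg]. Qed.

Lemma continuous_pair_fst (f : R -> R) :
  continuous f -> continuous (fun z : R * R => f z.1).
Proof.
move=> cf z; apply: (@continuous_comp _ _ _ (fun z : R * R => z.1) f).
  exact: cvg_fst.
exact: cf.
Qed.

Lemma continuous_pair_snd (f : R -> R) :
  continuous f -> continuous (fun z : R * R => f z.2).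
Proof.
move=> cf z; apply: (@continuous_comp _ _ _ (fun z : R * R => z.2) f).
  exact: cvg_snd.
exact: cf.
Qed.

Lemma continuous_pairN (f : R * R -> R) :
  continuous f -> continuous (fun z => - f z).
Proof. by move=> cf z; apply: (@cvgN _ R^o); exact: cf. Qed.

Lemma continuous_pairX (f : R * R -> R) n :
  continuous f -> continuous (fun z => f z ^+ n).
Proof.
move=> cf z; apply: (@continuous_comp _ _ _ f (fun y => y ^+ n)); first exact: cf.
exact: exprn_continuous.
Qed.

Lemma fst_continuous : continuous (fun z : R * R => z.1).
Proof. by move=> z; exact: cvg_fst. Qed.

Lemma snd_continuous : continuous (fun z : R * R => z.2).
Proof. by move=> z; exact: cvg_snd. Qed.

End PairContinuity.

Ltac continuous_pair :=
  lazymatch goal with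
  | |- continuous (fun _ => ?c) => exact: cst_continuous
  | |- continuous (fun z => @?f z + @?g z) =>
      apply: (@continuous_pairD _ f g); continuous_pair
  | |- continuous (fun z => - @?f z) => apply: (@continuous_pairN _ f); continuous_pair
  | |- continuous (fun z => @?f z * @?g z) =>
      apply: (@continuous_pairM _ f g); continuous_pair
  | |- continuous (fun z => @?f z ^+ ?n) =>
      apply: (@continuous_pairX _ f n); continuous_pair
  | |- continuous (fun z => fst z) => exact: fst_continuous
  | |- continuous (fun z => snd z) => exact: snd_continuous
  | |- _ => assumption
  end.

Section Viscosity.
Context {R : realType}.
Implicit Types (V Vx Vxx Vt w phi phix phixx phit : R -> R -> R).

(** Test functions, unlike the approximations, need continuous derivatives: an inequality found at a
    nearby maximum point is carried back to the point of contact. *)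
Definition C21 phi phix phixx phit : Prop :=
  [/\ smooth21 phi phix phixx phit,
      continuous (fun z : R * R => phix z.1 z.2),
      continuous (fun z : R * R => phixx z.1 z.2) &
      continuous (fun z : R * R => phit z.1 z.2)].

Lemma is_derive_sqr (s c : R) :
  is_derive s (1 : R) (fun s => (s - c) ^+ 2) (2 * (s - c)).
Proof.
have -> : (fun s : R => (s - c) ^+ 2) = (shift (- c)) * (shift (- c)).
  by apply/funext => y; rewrite expr2.
have d := is_derive_shift s (1 : R) (- c).
apply: is_derive_eq; rewrite /GRing.scale /= mulr1; ring.
Qed.

Lemma C21_separable (X X' X'' T T' : R -> R) :
  (forall x, is_derive x (1 : R) X (X' x)) ->
  (forall x, is_derive x (1 : R) X' (X'' x)) -> continuous X'' ->
  (forall t, is_derive t (1 : R) T (T' t)) -> continuous T' ->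
  C21 (fun x t => X x * T t) (fun x t => X' x * T t) (fun x t => X'' x * T t)
    (fun x t => X x * T' t).
Proof.
move=> dX dX' cX'' dT cT'.
have cX := is_derive_continuous dX; have cX' := is_derive_continuous dX'.
have cT := is_derive_continuous dT.
have dc (f : R -> R) (d c x : R) : is_derive x (1 : R) f d ->
    is_derive x (1 : R) (fun x => f x * c) (d * c).
  move=> df; have -> : (fun x => f x * c) = (fun x => c * f x).
    by apply/funext => y; rewrite mulrC.
  by rewrite mulrC; exact: is_derive_cM.
by split; [split => [|x t|x t|x t]|..];
  do ?[apply: continuous_pairM; [exact: continuous_pair_fst|exact: continuous_pair_snd]];
  [exact: dc|exact: dc|exact: is_derive_cM].
Qed.

Lemma C21D phi phix phixx phit psi psix psixx psit :
  C21 phi phix phixx phit -> C21 psi psix psixx psit ->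
  C21 (fun x t => phi x t + psi x t) (fun x t => phix x t + psix x t)
    (fun x t => phixx x t + psixx x t) (fun x t => phit x t + psit x t).
Proof.
move=> [[c1 d1 d2 d3] c2 c3 c4] [[c1' d1' d2' d3'] c2' c3' c4'].
by split; [split => [|x t|x t|x t]|..];
  do ?[exact: continuous_pairD]; exact: is_deriveD.
Qed.

(* A formulation stable under sums and time shifts, so that differences of
   solutions can be compared without doubling of variables. *)
Definition locally_subsol (D be r : R) w (x0 t0 : R) : Prop :=
  exists2 d, 0 < d & forall e, 0 < e -> exists V Vx Vxx Vt,
    smooth21 V Vx Vxx Vt /\
    forall x t, `|x - x0| <= d -> `|t - t0| <= d ->
      `|V x t - w x t| <= e /\
      Vt x t - D * Vxx x t - be * Vx x t + r * V x t <= 0.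

Lemma derive_gt0_right (f : R -> R) (c d : R) : is_derive c (1 : R) f d -> 0 < d ->
  exists2 eta, 0 < eta & forall s, c < s -> s < c + eta -> f c < f s.
Proof.
move=> [df fd] d0.
have : (fun h : R => h^-1 *: ((f \o shift c) (h *: 1) - f c)) @ 0^' --> d.
  by rewrite -fd; exact: df.
move=> /cvgr_gt/(_ _ d0) [eta /= eta0 H]; exists eta => // s cs sc.
have sc0 : 0 < s - c by rewrite subr_gt0.
have /= := H (s - c).
rewrite sub0r normrN gtr0_norm// => /(_ _ (lt0r_neq0 sc0)).
rewrite [(s - c)%:A]mulr1 subrK /GRing.scale/= pmulr_rgt0 ?invr_gt0// subr_gt0.
by apply; lra.
Qed.

Lemma interior_max_derive1 (f f' : R -> R) (c d : R) : 0 < d ->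
  (forall x, is_derive x (1 : R) f (f' x)) ->
  (forall x, `|x - c| <= d -> f x <= f c) -> f' c = 0.
Proof.
move=> d0 df fmax.
have [||||_ <-] := @derive1_at_max R f (c - d) (c + d) c.
- lra.
- by move=> t _; apply: ex_derive.
- by rewrite in_itv/=; lra.
- move=> t; rewrite in_itv/= => H; apply: fmax; rewrite ler_norml; lra.
- by rewrite derive_val.
Qed.

(** If [f'' c] were positive, [f'] would be positive just to the right of [c], and the mean value
    theorem would lift [f] above [f c]. Continuity of [f''] does not enter, in accordance with
    [smooth21]. *)
Lemma interior_max_derive (f f' f'' : R -> R) (c d : R) : 0 < d ->
  (forall x, is_derive x (1 : R) f (f' x)) ->
  (forall x, is_derive x (1 : R) f' (f'' x)) ->
  (forall x, `|x - c| <= d -> f x <= f c) -> f' c = 0 /\ f'' c <= 0.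
Proof.
move=> d0 df df' fmax.
have f'0 := interior_max_derive1 d0 df fmax.
split => //; rewrite leNgt; apply/negP => f''0.
have [eta eta0 H] := derive_gt0_right (df' c) f''0.
pose s := c + Num.min d eta / 2.
have m0 : 0 < Num.min d eta by rewrite lt_min d0.
have md : Num.min d eta <= d by rewrite ge_min lexx.
have me : Num.min d eta <= eta by rewrite ge_min lexx orbT.
have cs : c < s by rewrite /s; lra.
have cf : {within `[c, s], continuous f}.
  by apply: continuous_subspaceT; exact: is_derive_continuous df.
have [u /andP] := @MVT R f f' c s cs (fun x _ => df x) cf.
rewrite ?bnd_simp => -[cu us] E.
have : 0 < f s - f c.
  rewrite E mulr_gt0 ?subr_gt0//.
  by rewrite -f'0; apply: H => //; move: us; rewrite /s; lra.
have : f s <= f c by apply: fmax; rewrite ler_norml /s; lra.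
lra.
Qed.

Lemma subsol_touching (D be r : R) w phi phix phixx phit (x0 t0 d0 : R) :
  0 < D -> 0 < r -> locally_subsol D be r w x0 t0 ->
  C21 phi phix phixx phit -> 0 < d0 ->
  (forall x t, `|x - x0| <= d0 -> `|t - t0| <= d0 ->
     w x t - phi x t <= w x0 t0 - phi x0 t0) ->
  phit x0 t0 - D * phixx x0 t0 - be * phix x0 t0 + r * w x0 t0 <= 0.
Proof.
move=> D0 r0 [d1 d10 subs] [[c1 dp1 dp2 dp3] c2 c3 c4] d00 wmax.
rewrite leNgt; apply/negP; set Q := (X in 0 < X) => Q0.
(* The quadratic penalty makes the maximum strict, so that the approximations
   also have an interior maximum; this [nu] costs only half of [Q]. *)
pose nu := Q / (4 * D).
have nu0 : 0 < nu by rewrite divr_gt0// mulr_gt0.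
have nuQ : 4 * D * nu = Q by rewrite /nu; field; lra.
(* The operator applied to [phi] plus the penalty, with the zeroth-order term shifted so that its
   argument equals [w x0 t0] at [(x0, t0)]. *)
pose F (z : R * R) := phit z.1 z.2 + 2 * nu * (z.2 - t0)
  - D * (phixx z.1 z.2 + 2 * nu) - be * (phix z.1 z.2 + 2 * nu * (z.1 - x0))
  + r * (phi z.1 z.2 + nu * ((z.1 - x0) ^+ 2 + (z.2 - t0) ^+ 2) - phi x0 t0 + w x0 t0).
have cF : continuous F.
  by rewrite /F; continuous_pair.
have F0 : F (x0, t0) = Q / 2.
  have -> : F (x0, t0) = Q - 2 * D * nu by rewrite /F /Q /=; ring.
  lra.
have /cvgrPdist_lt/(_ (Q / 4)) := cF (x0, t0).
rewrite divr_gt0// => /(_ isT) /nbhs_ballP [d2 /= d20 Fd].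
pose de := Num.min (d2 / 2) (Num.min d0 d1).
have de0 : 0 < de by rewrite !lt_min d00 d10 divr_gt0.
have de2 : de <= d2 / 2 by rewrite ge_min lexx.
have ded0 : de <= d0 by rewrite !ge_min lexx orbT.
have ded1 : de <= d1 by rewrite !ge_min lexx !orbT.
have FQ x t : `|x - x0| <= de -> `|t - t0| <= de -> Q / 4 < F (x, t).
  move=> xd td; have : `|F (x0, t0) - F (x, t)| < Q / 4.
    by apply: Fd; split; rewrite /ball/= distrC; lra.
  by rewrite F0 ltr_norml; lra.
(* The first bound makes the penalty at the edge of the box exceed the total error 2 e, so the
   maximum is interior. The second keeps r e below the Q / 4 by which the operator is positive. *)
pose e := Num.min (nu * de ^+ 2 / 4) (Q / (8 * r)).
have e0 : 0 < e.
  by rewrite lt_min; apply/andP; split; rewrite divr_gt0// mulr_gt0// exprn_gt0.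
have e1 : 4 * e <= nu * de ^+ 2.
  have : e <= nu * de ^+ 2 / 4 by rewrite ge_min lexx.
  lra.
have e2 : r * e <= Q / 8.
  have : e <= Q / (8 * r) by rewrite ge_min lexx orbT.
  rewrite ler_pdivlMr; last by rewrite mulr_gt0.
  lra.
have [V [Vx [Vxx [Vt [[cV dV1 dV2 dV3] HV]]]]] := subs e e0.
pose psi x t := phi x t + nu * ((x - x0) ^+ 2 + (t - t0) ^+ 2).
have [[x1 t1] /= K1 Kmax] : exists2 z : R * R, z \in box x0 t0 de & forall y, y \in box x0 t0 de ->
    V y.1 y.2 - psi y.1 y.2 <= V z.1 z.2 - psi z.1 z.2.
  apply: compact_EVT_max; [|exact: box_compact|].
    by exists (x0, t0); apply/boxP; rewrite !subrr normr0 ltW.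
  by apply: continuous_subspaceT; rewrite /psi; continuous_pair.
move: K1; rewrite inE => /boxP [x1d t1d].
have {}Kmax x t : `|x - x0| <= de -> `|t - t0| <= de ->
    V x t - psi x t <= V x1 t1 - psi x1 t1.
  by move=> xd td; apply: (Kmax (x, t)); rewrite inE; apply/boxP.
have M0 := Kmax x0 t0; rewrite !subrr normr0 (ltW de0) in M0.
have {}M0 := M0 isT isT.
have psi0 : psi x0 t0 = phi x0 t0 by rewrite /psi !subrr expr0n addr0 mulr0 addr0.
have [] := HV x0 t0; rewrite ?subrr ?normr0 ?(ltW d10)// ler_norml => V0 _.
have [] := HV x1 t1 (le_trans x1d ded1) (le_trans t1d ded1); rewrite ler_norml => V1 V1le.
have W1 := wmax x1 t1 (le_trans x1d ded0) (le_trans t1d ded0).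
have sq : (x1 - x0) ^+ 2 + (t1 - t0) ^+ 2 < de ^+ 2.
  rewrite -(ltr_pM2l nu0) -/(psi _ _).
  have : psi x1 t1 = phi x1 t1 + nu * ((x1 - x0) ^+ 2 + (t1 - t0) ^+ 2) by [].
  rewrite psi0 in M0; move: M0 V0 V1 W1 e1 e0; clear; lra.
have x1lt : `|x1 - x0| < de.
  rewrite -(ltr_pXn2r (n := 2)) ?nnegrE ?(ltW de0)// real_normK ?num_real//.
  by have := sqr_ge0 (t1 - t0); move: sq; clear; lra.
have t1lt : `|t1 - t0| < de.
  rewrite -(ltr_pXn2r (n := 2)) ?nnegrE ?(ltW de0)// real_normK ?num_real//.
  by have := sqr_ge0 (x1 - x0); move: sq; clear; lra.
pose h := Num.min (de - `|x1 - x0|) (de - `|t1 - t0|).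
have h0 : 0 < h by rewrite lt_min !subr_gt0 x1lt.
have hx : h <= de - `|x1 - x0| by rewrite ge_min lexx.
have ht : h <= de - `|t1 - t0| by rewrite ge_min lexx orbT.
have near1 (u v c : R) : `|u - v| <= h -> h <= de - `|v - c| -> `|u - c| <= de.
  move=> uv hc; have -> : u - c = (u - v) + (v - c) by ring.
  by apply: le_trans (ler_normD _ _) _; move: uv hc; clear; lra.
have dM (f : R -> R) (c' d s : R) : is_derive s (1 : R) f d ->
    is_derive s (1 : R) (fun s => nu * (f s + c')) (nu * d).
  move=> fd; apply: is_derive_cM; rewrite -[d]addr0.
  by apply: is_deriveD.
have dM' (f : R -> R) (c' d s : R) : is_derive s (1 : R) f d ->
    is_derive s (1 : R) (fun s => nu * (c' + f s)) (nu * d).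
  move=> fd; apply: is_derive_cM; rewrite -[d]add0r.
  by apply: is_deriveD.
have [Ex Exx] : Vx x1 t1 - (phix x1 t1 + nu * (2 * (x1 - x0))) = 0 /\
    Vxx x1 t1 - (phixx x1 t1 + nu * (2 * 1)) <= 0.
  apply: (@interior_max_derive (fun x => V x t1 - psi x t1)
    (fun x => Vx x t1 - (phix x t1 + nu * (2 * (x - x0))))
    (fun x => Vxx x t1 - (phixx x t1 + nu * (2 * 1))) _ h h0).
  - move=> x; apply: is_deriveB; apply: is_deriveD; apply: dM; exact: is_derive_sqr.
  - move=> x; apply: is_deriveB; apply: is_deriveD; apply: is_derive_cM.
    by apply: is_derive_cM; exact: is_derive_shift.
  - by move=> x xh; apply: Kmax => //; exact: near1 xh hx.
have Et : Vt x1 t1 - (phit x1 t1 + nu * (2 * (t1 - t0))) = 0.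
  apply: (@interior_max_derive1 (fun t => V x1 t - psi x1 t)
    (fun t => Vt x1 t - (phit x1 t + nu * (2 * (t - t0)))) _ h h0).
  - move=> t; apply: is_deriveB; apply: is_deriveD; apply: dM'; exact: is_derive_sqr.
  - by move=> t th; apply: Kmax => //; exact: near1 th ht.
have FQ1 := FQ x1 t1 x1d t1d.
have D1 : D * Vxx x1 t1 <= D * (phixx x1 t1 + 2 * nu).
  by rewrite ler_pM2l//; move: Exx; clear; lra.
have bE : be * Vx x1 t1 = be * (phix x1 t1 + 2 * nu * (x1 - x0)).
  by congr (_ * _); move: Ex; clear; lra.
have r1 : r * (phi x1 t1 + nu * ((x1 - x0) ^+ 2 + (t1 - t0) ^+ 2) - phi x0 t0
    + w x0 t0 - e) <= r * V x1 t1.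
  rewrite ler_pM2l//; move: M0 V0; rewrite psi0 /psi; clear; lra.
move: FQ1 D1 bE r1 V1le Et e2 Q0; rewrite /F /=; clear; lra.
Qed.

End Viscosity.

(** * Maximum principle *)

Section MaximumPrinciple.
Context {R : realType}.
Implicit Types (w S Sx Sxx St : R -> R -> R).

Lemma rectP (x1 x2 t1 t2 x t : R) :
  (`[x1, x2] `*` `[t1, t2]) (x, t) <-> x1 <= x <= x2 /\ t1 <= t <= t2.
Proof. by rewrite /= !in_itv/=. Qed.

Lemma is_derive_expR_affine (k c t : R) :
  is_derive t (1 : R) (fun t => expR (k * (t - c))) (k * expR (k * (t - c))).
Proof.
have E : (fun t : R => expR (k * (t - c))) = (fun t => expR (k * t + - (k * c))).
  by apply/funext => s; rewrite mulrBr.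
rewrite E mulrBr; exact: (@is_derive_affine R expR k (- (k * c)) t).
Qed.

Lemma continuous_expR_affine (k c : R) : continuous (fun t : R => expR (k * (t - c))).
Proof. exact: is_derive_continuous (fun t => is_derive_expR_affine k c t). Qed.

(** Touching needs a neighbourhood on both sides in time, so the final time is left out here. The
    subsolution property is asked only where [S x t < w x t], which is where the offending maximum
    lies; this is what lets the obstacle in. *)
Lemma max_principle_lt (D be r : R) w S Sx Sxx St (xl xr t0 t1 : R) :
  0 < D -> 0 < r -> C21 S Sx Sxx St ->
  {within `[xl, xr] `*` `[t0, t1], continuous (fun z : R * R => w z.1 z.2)} ->
  (forall x t, xl < x < xr -> t0 < t < t1 ->
     0 <= St x t - D * Sxx x t - be * Sx x t + r * S x t) ->
  (forall t, t0 <= t <= t1 -> w xl t <= S xl t) ->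
  (forall t, t0 <= t <= t1 -> w xr t <= S xr t) ->
  (forall x, xl <= x <= xr -> w x t0 <= S x t0) ->
  (forall x t, xl < x < xr -> t0 < t < t1 -> S x t < w x t ->
     locally_subsol D be r w x t) ->
  forall x t, xl <= x <= xr -> t0 <= t < t1 -> w x t <= S x t.
Proof.
move=> D0 r0 CS cw MS bl br b0 sub xs ts /andP[xls xsr] /andP[t0s tst1].
rewrite leNgt; apply/negP => lt_S_w.
have [[cS dS1 dS2 dS3] cSx cSxx cSt] := CS.
set m := (w xs ts - S xs ts) / 2.
have m0 : 0 < m by rewrite divr_gt0// subr_gt0.
have mE : w xs ts - S xs ts = 2 * m by rewrite /m; field.
pose E : set (R * R) := `[xl, xr] `*` `[t0, t1].
have cE : compact E by apply: compact_setX; exact: segment_compact.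
have cwS : {within E, continuous (fun z : R * R => w z.1 z.2 - S z.1 z.2)}.
  have cS' : {within E, continuous (fun z : R * R => S z.1 z.2)} by exact: continuous_subspaceT.
  by move=> z; apply: (@cvgB _ R^o); [exact: cw|exact: cS'].
have Es : E (xs, ts) by apply/rectP; rewrite xls xsr t0s (ltW tst1).
have [zB _ HB] := compact_EVT_max (ex_intro _ _ Es) cE cwS.
pose B := w zB.1 zB.2 - S zB.1 zB.2.
have {}HB x t : E (x, t) -> w x t - S x t <= B.
  by move=> Ext; apply: (HB (x, t)); rewrite inE.
have Bm : 2 * m <= B by rewrite -mE; exact: HB.
pose t' := (ts + t1) / 2.
have tst' : ts < t' by rewrite /t'; lra.
have t't1 : t' < t1 by rewrite /t'; lra.
(* The exponential penalty [P] is [m] at time [ts] but exceeds the bound [B] at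
   time [t'], which keeps the maximum away from the final time. *)
pose k := B / (m * (t' - ts)).
have B0 : 0 < B by move: Bm m0; clear; lra.
have k0 : 0 < k by rewrite divr_gt0// mulr_gt0// subr_gt0.
pose P (t : R) := m * expR (k * (t - ts)).
pose P' (t : R) := m * (k * expR (k * (t - ts))).
have dP t : is_derive t (1 : R) P (P' t).
  by apply: is_derive_cM; exact: is_derive_expR_affine.
have P0 t : 0 < P t by rewrite mulr_gt0// expR_gt0.
have P'0 t : 0 < P' t by rewrite mulr_gt0// mulr_gt0// expR_gt0.
have Pts : P ts = m by rewrite /P subrr mulr0 expR0 mulr1.
have Pt' : B < P t'.
  have H := expR_ge1Dx (k * (t' - ts)).
  have kE : m * (k * (t' - ts)) = B by rewrite /k; field; rewrite subr_eq0; lra.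
  have : m * (1 + k * (t' - ts)) <= P t' by rewrite ler_pM2l.
  lra.
have cP' : continuous P'.
  move=> t; apply: (@cvgM R); first exact: cvg_cst.
  by apply: (@cvgM R); [exact: cvg_cst|exact: continuous_expR_affine].
have CP : C21 (fun x t => 1 * P t) (fun x t => 0 * P t) (fun x t => 0 * P t) (fun x t => 1 * P' t).
  apply: (@C21_separable R (fun=> 1) (fun=> 0) (fun=> 0)) => //.
  by move=> x; exact: cvg_cst.
have CSP := C21D CS CP.
pose E' : set (R * R) := `[xl, xr] `*` `[t0, t'].
have cE' : compact E' by apply: compact_setX; exact: segment_compact.
have subE : E' `<=` E.
  move=> [x t] /rectP [h0 /andP[h1 h2]]; apply/rectP; split => //.
  by rewrite h1 (le_trans h2 (ltW t't1)).
have E's : E' (xs, ts) by apply/rectP; rewrite xls xsr t0s (ltW tst').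
have cF : {within E', continuous (fun z : R * R => w z.1 z.2 - (S z.1 z.2 + 1 * P z.2))}.
  have [[c _ _ _] _ _ _] := CSP.
  have c' : {within E', continuous (fun z : R * R => S z.1 z.2 + 1 * P z.2)}.
    exact: continuous_subspaceT.
  have cw' : {within E', continuous (fun z : R * R => w z.1 z.2)} by exact: continuous_subspaceW cw.
  by move=> z; apply: (@cvgB _ R^o); [exact: cw'|exact: c'].
have [[x t] Kxt Hmax] := compact_EVT_max (ex_intro _ _ E's) cE' cF.
have {}Hmax x' t'' : E' (x', t'') -> w x' t'' - (S x' t'' + 1 * P t'') <= w x t - (S x t + 1 * P t).
  by move=> H; apply: (Hmax (x', t'')); rewrite inE.
move: Kxt; rewrite inE => Kxt.
have /rectP [/andP[xlx xxr] /andP[t0t tt']] := Kxt.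
have Hs := Hmax xs ts E's.
have val : m <= w x t - S x t - P t by move: Hs mE; rewrite Pts; clear; lra.
have wS : P t < w x t - S x t by move: val m0; clear; lra.
have Pt0 := P0 t.
have lt1 : xl < x.
  rewrite lt_neqAle xlx andbT; apply/eqP => xE.
  have := bl t; rewrite t0t (ltW (le_lt_trans tt' t't1)) xE => /(_ isT).
  by move: wS Pt0; clear; lra.
have lt2 : x < xr.
  rewrite lt_neqAle xxr andbT; apply/eqP => xE.
  have := br t; rewrite t0t (ltW (le_lt_trans tt' t't1)) -xE => /(_ isT).
  by move: wS Pt0; clear; lra.
have lt3 : t0 < t.
  rewrite lt_neqAle t0t andbT; apply/eqP => tE.
  have := b0 x; rewrite xlx xxr tE => /(_ isT).
  by move: wS Pt0; clear; lra.
have lt4 : t < t'.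
  rewrite lt_neqAle tt' andbT; apply/eqP => tE.
  have := HB x t (subE _ Kxt).
  by move: wS Pt'; rewrite tE; clear; lra.
have xin : xl < x < xr by rewrite lt1.
have tin : t0 < t < t1 by rewrite lt3 (lt_trans lt4).
have Sw : S x t < w x t by move: wS Pt0; clear; lra.
pose d := Num.min (Num.min (x - xl) (xr - x)) (Num.min (t - t0) (t' - t)).
have d0 : 0 < d by rewrite !lt_min !subr_gt0 lt1 lt2 lt3.
have [d1 d2 d3 d4] : [/\ d <= x - xl, d <= xr - x, d <= t - t0 & d <= t' - t].
  by split; rewrite /d !ge_min lexx ?orbT.
have := @subsol_touching R D be r w _ _ _ _ x t d D0 r0 (sub x t xin tin Sw) CSP d0.
have loc : forall x' t'', `|x' - x| <= d -> `|t'' - t| <= d ->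
    w x' t'' - (S x' t'' + 1 * P t'') <= w x t - (S x t + 1 * P t).
  move=> x' t'' H1 H2; apply: Hmax; apply/rectP.
  move: H1 H2 d1 d2 d3 d4; rewrite !ler_norml; clear; lra.
move=> /(_ loc).
have M := MS x t xin tin.
have rw : 0 < r * (w x t - S x t) by rewrite mulr_gt0// subr_gt0.
by move: M rw (P'0 t); clear; lra.
Qed.

(** The final time is added by continuity: a violation at [t1] would persist at slightly earlier
    times. *)
Lemma max_principle (D be r : R) w S Sx Sxx St (xl xr t0 t1 : R) :
  0 < D -> 0 < r -> t0 < t1 -> C21 S Sx Sxx St ->
  {within `[xl, xr] `*` `[t0, t1], continuous (fun z : R * R => w z.1 z.2)} ->
  (forall x t, xl < x < xr -> t0 < t < t1 ->
     0 <= St x t - D * Sxx x t - be * Sx x t + r * S x t) ->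
  (forall t, t0 <= t <= t1 -> w xl t <= S xl t) ->
  (forall t, t0 <= t <= t1 -> w xr t <= S xr t) ->
  (forall x, xl <= x <= xr -> w x t0 <= S x t0) ->
  (forall x t, xl < x < xr -> t0 < t < t1 -> S x t < w x t ->
     locally_subsol D be r w x t) ->
  forall x t, xl <= x <= xr -> t0 <= t <= t1 -> w x t <= S x t.
Proof.
move=> D0 r0 t01 CS cw MS bl br b0 sub x t xin /andP[t0t].
rewrite le_eqVlt => /orP[/eqP tE|tt1]; last first.
  by apply: (max_principle_lt D0 r0 CS cw MS bl br b0 sub) => //; rewrite t0t.
have H := max_principle_lt D0 r0 CS cw MS bl br b0 sub.
rewrite leNgt; apply/negP => lt_S_w.
have [[cS _ _ _] _ _ _] := CS.
pose E : set (R * R) := `[xl, xr] `*` `[t0, t1].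
have cwS : {within E, continuous (fun z : R * R => w z.1 z.2 - S z.1 z.2)}.
  have cS' : {within E, continuous (fun z : R * R => S z.1 z.2)} by exact: continuous_subspaceT.
  by move=> z; apply: (@cvgB _ R^o); [exact: cw|exact: cS'].
have Ext : E (x, t) by apply/rectP; rewrite xin t0t tE lexx.
have /subspace_continuousP/(_ _ Ext)/cvgr_gt/(_ 0) := cwS.
rewrite /= subr_gt0 => /(_ lt_S_w).
rewrite near_withinE => /nbhs_ballP [d /= d0 Hd].
pose s := Num.max t0 (t1 - d / 2).
have st0 : t0 <= s by rewrite le_max lexx.
have sd : t1 - d / 2 <= s by rewrite le_max lexx orbT.
have st1 : s < t1 by rewrite gt_max t01; lra.
have : 0 < w x s - S x s.
  apply: (Hd (x, s)) => /=.
    split => /=; first exact: ballxx.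
    rewrite /ball/= tE ger0_norm ?subr_ge0 ?(ltW st1)//; lra.
  by apply/rectP; rewrite xin st0 (ltW st1).
have := H x s xin; rewrite st0 st1 => /(_ isT); lra.
Qed.

End MaximumPrinciple.

(** * The strong solution *)

Section LocalSubsolutions.
Context {R : realType} (D be r : R).
Implicit Types w : R -> R -> R.

Lemma locally_subsolD w1 w2 x0 t0 :
  locally_subsol D be r w1 x0 t0 -> locally_subsol D be r w2 x0 t0 ->
  locally_subsol D be r (fun x t => w1 x t + w2 x t) x0 t0.
Proof.
move=> [d1 d10 H1] [d2 d20 H2]; exists (Num.min d1 d2); first by rewrite lt_min d10.
move=> e e0.
have e20 : 0 < e / 2 by rewrite divr_gt0.
have [V [Vx [Vxx [Vt [[c1 a1 b1 f1] P1]]]]] := H1 _ e20.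
have [U [Ux [Uxx [Ut [[c2 a2 b2 f2] P2]]]]] := H2 _ e20.
exists (fun x t => V x t + U x t), (fun x t => Vx x t + Ux x t),
  (fun x t => Vxx x t + Uxx x t), (fun x t => Vt x t + Ut x t); split.
  split => [|x t|x t|x t]; first exact: continuous_pairD;
    exact: is_deriveD.
move=> x t; rewrite !le_min => /andP[x1 x2] /andP[t1 t2].
have [E1 M1] := P1 x t x1 t1; have [E2 M2] := P2 x t x2 t2; split.
  move: E1 E2; rewrite !ler_norml; clear; lra.
by move: M1 M2; clear; lra.
Qed.

Lemma locally_subsol_shift w h x0 t0 :
  locally_subsol D be r w x0 (t0 + h) ->
  locally_subsol D be r (fun x t => w x (t + h)) x0 t0.
Proof.
move=> [d d0 H]; exists d => // e e0.
have [V [Vx [Vxx [Vt [[c1 a1 b1 f1] P1]]]]] := H _ e0.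
exists (fun x t => V x (t + h)), (fun x t => Vx x (t + h)),
  (fun x t => Vxx x (t + h)), (fun x t => Vt x (t + h)); split; last first.
  move=> x t xd td; apply: P1 => //.
  by rewrite opprD addrACA subrr addr0.
split => // [|x t].
  move=> z; apply: (@continuous_comp _ _ _ (fun z : R * R => (z.1, z.2 + h))
    (fun z : R * R => V z.1 z.2)); last exact: c1.
  have c : (fun z : R * R => z.2 + h) @ z --> z.2 + h.
    by apply: (@cvgD _ R^o); [exact: cvg_snd|exact: cvg_cst].
  exact: (cvg_pair (@cvg_fst _ _ _ _ _) c).
have H1 := @is_derive_affine R (V x) 1 h t (Vt x (t + h)).
have E : (fun s => V x (1 * s + h)) = (fun t => V x (t + h)).
  by apply/funext => s; rewrite mul1r.
by rewrite -E -[Vt x (t + h)]mul1r; apply: H1; rewrite mul1r.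
Qed.

End LocalSubsolutions.

Section StrongSolutions.
Context {R : realType} (K1 k2 K2 sigma r q T : R) (p : R) (Y : R * R -> R).
Hypothesis solY : strong_solution K1 k2 K2 sigma r q T p Y.
Local Notation D := (sigma ^+ 2 / 2).
Local Notation be := (r - q - sigma ^+ 2 / 2).

Lemma domQ_int_open : open (domQ_int k2 T).
Proof.
have ox : open [set` `]ln k2, +oo[] by exact: interval_open.
have ot : open [set` `]0, T[] by exact: interval_open.
rewrite openE => -[x t] [/= hx ht]; exists ([set` `]ln k2, +oo[], [set` `]0, T[]) => //=.
by split; apply: open_nbhs_nbhs.
Qed.

Lemma domQ_int_continuous : {in domQ_int k2 T, continuous Y}.
Proof.
have [Yx [Yxx [Yt [[cY _ _ _ _] _ _ _ _]]]] := solY.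
rewrite -continuous_open_subspace; last exact: domQ_int_open.
apply: continuous_subspaceW cY => -[x t]; rewrite /domQ_int /domQ_cl /= !in_itv/= !andbT.
by move=> [/ltW -> /andP[/ltW -> /ltW ->]].
Qed.

Lemma psi2_continuous : continuous (@psi2 R K1 k2 K2).
Proof.
move=> x.
have c1 : {for x, continuous (fun x : R => K2 - expR x)}.
  by apply: (@cvgB _ R^o); [exact: cvg_cst|exact: continuous_expR].
have c2 : {for x, continuous (fun x : R => Num.max (K2 - expR x) 0)}.
  by apply: (continuous_max c1); exact: cst_continuous.
exact: (@cvgB _ R^o _ _ _ _ _ _ _
  (@cvgD _ R^o _ _ _ _ _ _ _ c2 (@cvg_cst _ _ _ _ _)) (@cvg_cst _ _ _ _ _)).
Qed.

Lemma domQ_int_box x0 t0 : domQ_int k2 T (x0, t0) ->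
  forall P : R * R -> Prop, (\forall z \near (x0, t0), P z) ->
  exists2 d, 0 < d & box x0 t0 (d + d) `<=` domQ_int k2 T `&` P.
Proof.
move=> z0 P nP.
have : \forall z \near (x0, t0), domQ_int k2 T z /\ P z.
  by apply: filterI nP; apply: open_nbhs_nbhs; split => //; exact: domQ_int_open.
move=> /nbhs_ballP [d /= d0 H]; exists (d / 4); first by rewrite divr_gt0.
move=> [x t] /boxP [xd td]; apply: H; split; rewrite /ball/= distrC; lra.
Qed.

Lemma strong_solution_super (x0 t0 : R) : ln k2 < x0 -> 0 < t0 < T ->
  locally_subsol D be r (fun x t => - Y (x, t)) x0 t0.
Proof.
move=> x0a t0T.
have z0 : domQ_int k2 T (x0, t0) by rewrite /domQ_int /= !in_itv/= x0a t0T.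
have [Yx [Yxx [Yt [[_ wx wxx wt _] _ superY _ _]]]] := solY.
have nT : \forall z \near (x0, t0), (@setT (R * R)) z by exact: filterT.
have [d d0 sub] := domQ_int_box z0 nT.
exists d => // e e0.
have [|V [Vx [Vxx [Vt [[c1 d1 d2 d3] close sup _]]]]] :=
  mollify D be r domQ_int_continuous wx wxx wt d0 _ e0 (x0 := x0) (t0 := t0).
  by move=> z /sub [].
exists (fun x t => - V x t), (fun x t => - Vx x t),
  (fun x t => - Vxx x t), (fun x t => - Vt x t); split.
  by split => [|x t|x t|x t]; [exact: continuous_pairN|exact: is_deriveN..].
move=> x t xd td; split; first by rewrite -opprD normrN close.
suff : 0 <= Vt x t - D * Vxx x t - be * Vx x t + r * V x t by lra.
apply: sup => //; apply: ae_leb2_imply superY => z Hz Kz.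
have : domQ k2 T z.
  have [[h1 h2] _] := sub _ Kz; split => //.
  by move: h2; rewrite /= !in_itv/= => /andP[-> /ltW ->].
by move=> /Hz; rewrite /opL; lra.
Qed.

Lemma strong_solution_sub (x0 t0 : R) : ln k2 < x0 -> 0 < t0 < T ->
  psi2 K1 k2 K2 x0 < Y (x0, t0) ->
  locally_subsol D be r (fun x t => Y (x, t)) x0 t0.
Proof.
move=> x0a t0T noncontact.
have z0 : domQ_int k2 T (x0, t0) by rewrite /domQ_int /= !in_itv/= x0a t0T.
have [Yx [Yxx [Yt [[_ wx wxx wt _] _ _ eqY _]]]] := solY.
(* Noncontact is an open condition, so the equation holds almost everywhere on a whole box, as the
   averaging requires. *)
have nearP : \forall z \near (x0, t0), psi2 K1 k2 K2 z.1 < Y z.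
  have z0O : (x0, t0) \in domQ_int k2 T by rewrite inE.
  have c2 : continuous (fun z : R * R => psi2 K1 k2 K2 z.1).
    by apply: continuous_pair_fst; exact: psi2_continuous.
  have cd := @cvgB _ R^o _ _ _ _ _ _ _ (domQ_int_continuous z0O) (c2 (x0, t0)).
  have pos : 0 < Y (x0, t0) - psi2 K1 k2 K2 (x0, t0).1 by rewrite subr_gt0.
  have := cvgr_gt _ (cd _) 0 pos.
  by move=> /(_ _ _); apply: filterS => z; rewrite /= !fctE subr_gt0.
have [d d0 sub] := domQ_int_box z0 nearP.
exists d => // e e0.
have [|V [Vx [Vxx [Vt [[c1 d1 d2 d3] close _ sbs]]]]] :=
  mollify D be r domQ_int_continuous wx wxx wt d0 _ e0 (x0 := x0) (t0 := t0).
  by move=> z /sub [].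
exists V, Vx, Vxx, Vt; split => // x t xd td; split; first exact: close.
apply: sbs => //; apply: ae_leb2_imply eqY => z Hz Kz.
have [[h1 h2] h3] := sub _ Kz.
have : domQ k2 T z.
  split => //.
  by move: h2; rewrite /= !in_itv/= => /andP[-> /ltW ->].
by move=> /Hz/(_ h3); rewrite /opL; lra.
Qed.

End StrongSolutions.

(** * Barriers *)

Section Barriers.
Context {R : realType}.

Lemma is_derive_eqr (f : R -> R) (x d d' : R) :
  is_derive x (1 : R) f d -> d = d' -> is_derive x (1 : R) f d'.
Proof. by move=> H <-. Qed.

Lemma C21_eq (phi phix phixx phit psi psix psixx psit : R -> R -> R) :
  C21 phi phix phixx phit ->
  (forall x t, phi x t = psi x t) -> (forall x t, phix x t = psix x t) ->
  (forall x t, phixx x t = psixx x t) -> (forall x t, phit x t = psit x t) ->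
  C21 psi psix psixx psit.
Proof.
move=> C e1 e2 e3 e4.
have -> : psi = phi by apply/funext => x; apply/funext => t.
have -> : psix = phix by apply/funext => x; apply/funext => t.
have -> : psixx = phixx by apply/funext => x; apply/funext => t.
by have -> : psit = phit by apply/funext => x; apply/funext => t.
Qed.

(** Makes the tactic [continuous_pair] available for functions of one variable. *)
Lemma continuous_pair_curry (f : R -> R) : continuous (fun z : R * R => f z.1) -> continuous f.
Proof.
move=> cf x; have := @continuous_comp _ _ _ (fun x : R => (x, 0 : R)) (fun z : R * R => f z.1) x.
apply; last exact: cf.
have c : (fun x : R => 0 : R) @ x --> (0 : R) by exact: cvg_cst.
exact: (cvg_pair (@cvg_id _ _) c).
Qed.

Lemma C21_quadratic (A k x1 p g t1 : R) :
  C21 (fun x t => A + p * (x - x1) + k * (x - x1) ^+ 2 + g * (t - t1) ^+ 2)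
    (fun x t => p + 2 * k * (x - x1)) (fun x t => 2 * k) (fun x t => 2 * g * (t - t1)).
Proof.
have d1 (c s : R) : is_derive s (1 : R) (fun x : R => x - c) 1 by exact: is_derive_shift.
split; [split|..]; try continuous_pair.
- by move=> x t; apply: is_derive_eqr; rewrite /GRing.scale /=; ring.
- by move=> x t; apply: is_derive_eqr; rewrite /GRing.scale /=; ring.
- by move=> x t; apply: is_derive_eqr; rewrite /GRing.scale /=; ring.
Qed.

(* Minus the separable subsolution
   e (eta^2 - (x - y0)^2)^2 exp(- N (t - t0)), zero at |x - y0| = eta. *)
Definition decay (e N y0 eta t0 x t : R) : R :=
  - (e * (eta ^+ 2 - (x - y0) ^+ 2) ^+ 2 * expR (- N * (t - t0))).
Definition decayx (e N y0 eta t0 x t : R) : R :=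
  - (e * (-4 * (x - y0) * (eta ^+ 2 - (x - y0) ^+ 2)) * expR (- N * (t - t0))).
Definition decayxx (e N y0 eta t0 x t : R) : R :=
  - (e * (12 * (x - y0) ^+ 2 - 4 * eta ^+ 2) * expR (- N * (t - t0))).
Definition decayt (e N y0 eta t0 x t : R) : R :=
  e * (eta ^+ 2 - (x - y0) ^+ 2) ^+ 2 * (N * expR (- N * (t - t0))).

Lemma C21_decay (e N y0 eta t0 : R) :
  C21 (decay e N y0 eta t0) (decayx e N y0 eta t0) (decayxx e N y0 eta t0)
    (decayt e N y0 eta t0).
Proof.
pose m (x : R) := eta ^+ 2 - (x - y0) ^+ 2.
have dm (x : R) : is_derive x (1 : R) m (- (2 * (x - y0))).
  by apply: is_derive_eqr; rewrite /GRing.scale /=; ring.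
have ds (x : R) : is_derive x (1 : R) (fun x : R => x - y0) 1 by exact: is_derive_shift.
pose X (x : R) := (- e) * (m x * m x).
pose X' (x : R) := (4 * e) * ((x - y0) * m x).
pose X'' (x : R) := (- e) * (12 * (x - y0) ^+ 2 - 4 * eta ^+ 2).
have cX'' : continuous X''.
  by apply: continuous_pair_curry; rewrite /X''; continuous_pair.
have dX x : is_derive x (1 : R) X (X' x).
  apply: is_derive_eqr.
  by rewrite /X' /GRing.scale /=; ring.
have dX' x : is_derive x (1 : R) X' (X'' x).
  apply: is_derive_eqr.
  by rewrite /X'' /m /GRing.scale /=; ring.
have cT : continuous (fun t => - N * expR (- N * (t - t0))).
  by move=> t; apply: (@cvgM R); [exact: cvg_cst|exact: continuous_expR_affine].
apply: (C21_eq (C21_separable dX dX' cX'' (fun t => is_derive_expR_affine (- N) t0 t) cT)) => x t.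
- by rewrite /decay /X /m; ring.
- by rewrite /decayx /X' /m; ring.
- by rewrite /decayxx /X''; ring.
- by rewrite /decayt /X /m; ring.
Qed.

(* Chosen so that the terms in [eta ^+ 2 - (x - y0) ^+ 2] form a square. *)
Definition decay_rate (D be r eta : R) : R :=
  r + (12 * D + 4 * `|be| * eta) ^+ 2 / (32 * D * eta ^+ 2).

(** The profile is squared for the sake of the edge |x - y0| = eta: it vanishes there, but its
    second derivative tends to 8 e eta^2 > 0, so diffusion helps. Away from the edge the rate [N]
    dominates. *)
Lemma decay_supersol (D be r e y0 eta t0 x t N : R) :
  N = decay_rate D be r eta -> 0 < D -> 0 <= e -> 0 < eta ->
  y0 - eta < x < y0 + eta ->
  0 <= decayt e N y0 eta t0 x t - D * decayxx e N y0 eta t0 x t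
    - be * decayx e N y0 eta t0 x t + r * decay e N y0 eta t0 x t.
Proof.
move=> NE D0 e0 eta0 xin.
set E := expR (- N * (t - t0)).
have E0 : 0 < E by exact: expR_gt0.
pose s := x - y0; pose m := eta ^+ 2 - s ^+ 2.
have s1 : - eta < s by rewrite /s; lra.
have s2 : s < eta by rewrite /s; lra.
have m0 : 0 <= m.
  have -> : m = (eta - s) * (eta + s) by rewrite /m; ring.
  by rewrite mulr_ge0//; lra.
pose L := 12 * D + 4 * `|be| * eta.
(* Since s^2 = eta^2 - m, the factor of e E is (N - r) m^2 - 12 D m - 4 be s m + 8 D eta^2.
   Replacing be s by its bound |be| eta gives the completed square and leaves the last term. *)
have -> : decayt e N y0 eta t0 x t - D * decayxx e N y0 eta t0 x t
    - be * decayx e N y0 eta t0 x t + r * decay e N y0 eta t0 x t =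
  e * E * (8 * D * eta ^+ 2 * (1 - L * m / (16 * D * eta ^+ 2)) ^+ 2
     + 4 * m * (`|be| * eta - be * s)).
  rewrite /decayt /decayxx /decayx /decay -/E -/s NE /decay_rate /L /m /s.
  by field; rewrite ?gt_eqF.
rewrite mulr_ge0 ?(mulr_ge0 e0 (ltW E0))// addr_ge0//.
  by rewrite mulr_ge0 ?sqr_ge0// mulr_ge0 ?sqr_ge0// mulr_ge0 ?ltW.
rewrite mulr_ge0//; first by rewrite mulr_ge0.
rewrite subr_ge0 (le_trans (ler_norm _))// normrM ler_wpM2l// ler_norml; lra.
Qed.

(* Minus a subsolution e (exp(lam xi) - 1) that is positive only for
   xi = x0 - x - g (t - t0)^2 > 0, that is, inside a parabola with vertex (x0, t0). *)
Definition hopf (e lam g x0 t0 x t : R) : R :=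
  e - e * expR (lam * ((x0 - x) - g * (t - t0) ^+ 2)).

Lemma is_derive_gauss (k t0 t : R) :
  is_derive t (1 : R) (fun t => expR (k * (t - t0) ^+ 2))
    (k * (2 * (t - t0)) * expR (k * (t - t0) ^+ 2)).
Proof.
by apply: is_derive_eqr; rewrite /GRing.scale /=; ring.
Qed.

Lemma C21_hopf (e lam g x0 t0 : R) :
  let G x t := e * expR (lam * ((x0 - x) - g * (t - t0) ^+ 2)) in
  C21 (hopf e lam g x0 t0) (fun x t => lam * G x t) (fun x t => - lam ^+ 2 * G x t)
    (fun x t => 2 * lam * g * (t - t0) * G x t).
Proof.
move=> G.
pose X (x : R) := (- e) * expR (- lam * (x - x0)).
pose X' (x : R) := (- e) * (- lam * expR (- lam * (x - x0))).
pose X'' (x : R) := (- e) * (- lam * (- lam * expR (- lam * (x - x0)))).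
pose T (t : R) := expR (- (lam * g) * (t - t0) ^+ 2).
pose T' (t : R) := - (lam * g) * (2 * (t - t0)) * T t.
have dX x : is_derive x (1 : R) X (X' x) by apply: is_derive_cM; exact: is_derive_expR_affine.
have dX' x : is_derive x (1 : R) X' (X'' x).
  by apply: is_derive_cM; apply: is_derive_cM; exact: is_derive_expR_affine.
have cX'' : continuous X''.
  move=> x; apply: (@cvgM R); first exact: cvg_cst.
  apply: (@cvgM R); first exact: cvg_cst.
  by apply: (@cvgM R); [exact: cvg_cst|exact: continuous_expR_affine].
have dT t : is_derive t (1 : R) T (T' t) by exact: is_derive_gauss.
have cT : continuous T by exact: is_derive_continuous dT.
have cT' : continuous T'.
  have cT2 : continuous (fun z : R * R => T z.1) by exact: continuous_pair_fst.
  by apply: continuous_pair_curry; rewrite /T'; continuous_pair.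
(* The additive constant [e] enters as a degenerate quadratic. *)
have CH := C21D (C21_quadratic e 0 0 0 0 0) (C21_separable dX dX' cX'' dT cT').
have GE x t : expR (- lam * (x - x0)) * T t = expR (lam * ((x0 - x) - g * (t - t0) ^+ 2)).
  by rewrite /T -expRD; congr expR; ring.
apply: (C21_eq CH) => x t.
- by rewrite /hopf /X -mulrA GE; ring.
- by rewrite /X' /G -GE; ring.
- by rewrite /X'' /G -GE; ring.
- by rewrite /X /T' /G -GE; ring.
Qed.

(** Diffusion contributes D lam^2, the other terms grow at most linearly in [lam]. The value of
    [lam] makes D lam a sum of one bound for each of them plus D, and the final 1 gives lam >= 1,
    which the term in [r] needs. *)
Lemma hopf_supersol (D be r e g th x0 t0 x t lam G : R) :
  lam = (2 * g * th + `|be| + r) / D + 1 ->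
  G = e * expR (lam * ((x0 - x) - g * (t - t0) ^+ 2)) ->
  0 < D -> 0 < r -> 0 <= e -> 0 <= g -> 0 < th -> `|t - t0| <= th ->
  0 <= 2 * lam * g * (t - t0) * G - D * (- lam ^+ 2 * G) - be * (lam * G)
    + r * hopf e lam g x0 t0 x t.
Proof.
move=> lamE GE D0 r0 e0 g0 th0 tth.
have G0 : 0 <= G by rewrite GE mulr_ge0// expR_ge0.
have b0 : 0 <= `|be| by [].
have gth : 0 <= g * th by rewrite mulr_ge0// ltW.
have lamD : D * lam = 2 * g * th + `|be| + r + D by rewrite lamE; field; rewrite gt_eqF.
have lam1 : 1 <= lam.
  by rewrite lamE lerDr divr_ge0 ?(ltW D0)//; lra.
have -> : 2 * lam * g * (t - t0) * G - D * (- lam ^+ 2 * G) - be * (lam * G)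
    + r * hopf e lam g x0 t0 x t =
  r * e + G * (2 * lam * (g * (t - t0)) + (D * lam) * lam - be * lam - r).
  by rewrite /hopf -GE; ring.
rewrite addr_ge0// ?mulr_ge0 ?(ltW r0)//.
rewrite lamD.
have h1 : 0 <= lam * (g * th + g * (t - t0)).
  rewrite mulr_ge0//; first by lra.
  rewrite -mulrDr mulr_ge0//; move: tth; rewrite ler_norml; lra.
have h2 : 0 <= lam * (`|be| - be) by rewrite mulr_ge0 ?subr_ge0 ?ler_norm//; lra.
have h3 : 0 <= (lam - 1) * r by rewrite mulr_ge0 ?subr_ge0 ?(ltW r0).
have h4 : 0 <= lam * D by rewrite mulr_ge0 ?(ltW D0)//; lra.
lra.
Qed.

End Barriers.

(** * Comparison on a half-line *)

Section HalflineComparison.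
Context {R : realType}.

(* The constant [2 * D / r + be ^+ 2 / r ^+ 2] makes [x ^+ 2] plus it a
   supersolution, which serves as a penalty growing at infinity. *)
Lemma quadratic_supersol (D be r A k x : R) : 0 < D -> 0 < r -> 0 <= A -> 0 <= k ->
  0 <= 0 - D * (2 * k) - be * (2 * k * x) + r * (A + k * (2 * D / r + be ^+ 2 / r ^+ 2 + x ^+ 2)).
Proof.
move=> D0 r0 A0 k0.
have -> : 0 - D * (2 * k) - be * (2 * k * x)
    + r * (A + k * (2 * D / r + be ^+ 2 / r ^+ 2 + x ^+ 2)) =
  r * A + r * k * (x - be / r) ^+ 2 by field; rewrite gt_eqF.
by rewrite addr_ge0// mulr_ge0 ?sqr_ge0// ?mulr_ge0// ltW.
Qed.

(** A Phragmen-Lindelof argument: the bound [B] lets an arbitrarily small multiple of the quadratic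
    penalty win far out, and that multiple then tends to 0. Nonnegativity of [k0] makes the constant
    a supersolution. *)
Lemma halfline_comparison (D be r : R) (w : R -> R -> R) (xl t0 t1 k0 B : R) :
  0 < D -> 0 < r -> t0 < t1 -> 0 <= k0 ->
  {within `[xl, +oo[ `*` `[t0, t1], continuous (fun z : R * R => w z.1 z.2)} ->
  (forall x t, xl <= x -> t0 <= t <= t1 -> w x t <= B) ->
  (forall t, t0 <= t <= t1 -> w xl t <= k0) ->
  (forall x, xl <= x -> w x t0 <= k0) ->
  (forall x t, xl < x -> t0 < t < t1 -> k0 < w x t -> locally_subsol D be r w x t) ->
  forall x t, xl <= x -> t0 <= t <= t1 -> w x t <= k0.
Proof.
move=> D0 r0 t01 k00 cw wB wl w0 sub x t xlx tin.
pose C := 2 * D / r + be ^+ 2 / r ^+ 2.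
have C0 : 0 <= C by rewrite addr_ge0 ?divr_ge0 ?sqr_ge0 ?mulr_ge0 ?ltW.
have key d : 0 < d -> w x t <= k0 + d * (C + x ^+ 2).
  move=> d0; pose B' := Num.max B 0.
  have B'0 : 0 <= B' by rewrite le_max lexx orbT.
  have BB' : B <= B' by rewrite le_max lexx.
  (* Beyond [x], and at least 1, so that d X^2 >= d X >= B'. *)
  pose X := `|x| + 1 + B' / d.
  have Bd : 0 <= B' / d by rewrite divr_ge0// ltW.
  have X1 : 1 <= X by rewrite /X; have := normr_ge0 x; lra.
  have xX : x <= X by rewrite /X; have := ler_norm x; lra.
  have dX : B' <= d * X ^+ 2.
    have h1 : B' / d <= X by rewrite /X; have := normr_ge0 x; lra.
    have h2 : X <= X ^+ 2 by rewrite expr2 ler_peMr//; lra.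
    by rewrite mulrC -ler_pdivrMr//; exact: le_trans h2.
  pose A := k0 + d * C.
  have CS := C21_quadratic A d 0 0 0 0.
  have SE u s : A + 0 * (u - 0) + d * (u - 0) ^+ 2 + 0 * (s - 0) ^+ 2 = k0 + d * (C + u ^+ 2).
    by rewrite /A; ring.
  have ge u : k0 <= k0 + d * (C + u ^+ 2).
    by rewrite lerDl mulr_ge0 ?(ltW d0)// addr_ge0 ?sqr_ge0.
  rewrite -(SE x t); apply: (max_principle (be := be) (xl := xl) (xr := X) D0 r0 t01 CS) => //.
  - apply: continuous_subspaceW cw => -[u s] [/=]; rewrite !in_itv/= => /andP[-> _] ->.
    by [].
  - move=> u s _ _; rewrite SE.
    have := quadratic_supersol be u D0 r0 k00 (ltW d0).
    by rewrite -/C; lra.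
  - by move=> s sin; rewrite SE; apply: le_trans (ge _); exact: wl.
  - move=> s sin; rewrite SE.
    apply: (le_trans (wB _ _ (le_trans xlx xX) sin)); apply: (le_trans BB').
    by have := mulr_ge0 (ltW d0) C0; lra.
  - by move=> u /andP[xu _]; rewrite SE; apply: le_trans (ge _); exact: w0.
  - move=> u s /andP[xu _] sin; rewrite SE => wu; apply: sub => //.
    exact: le_lt_trans wu.
  - by rewrite xlx.
rewrite leNgt; apply/negP => k0w.
have Cx : 0 <= C + x ^+ 2 by rewrite addr_ge0 ?sqr_ge0.
(* With this [d] the penalty at [x] is at most half of the excess [w x t - k0]. *)
have := key ((w x t - k0) / (2 * (C + x ^+ 2 + 1))).
rewrite divr_gt0 ?subr_gt0 ?mulr_gt0//; last by lra.
move=> /(_ isT).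
have -> : (w x t - k0) / (2 * (C + x ^+ 2 + 1)) * (C + x ^+ 2) =
  (w x t - k0) / 2 * ((C + x ^+ 2) / (C + x ^+ 2 + 1)) by field; rewrite gt_eqF//; lra.
have : (C + x ^+ 2) / (C + x ^+ 2 + 1) <= 1 by rewrite ler_pdivrMr; lra.
set v := (X in X <= 1) => v1.
have : (w x t - k0) / 2 * v <= (w x t - k0) / 2.
  by rewrite ler_piMr// divr_ge0// subr_ge0 ltW.
rewrite -/v; lra.
Qed.

End HalflineComparison.

(** * The free boundary of the obstacle problem *)

Section ObstacleProblem.
(** In the application a = ln k2, b = ln K2, c = k2 - K1 and D = sigma^2/2. The payoff is retained
    only through its constant value to the right of [b] and its growth, at rate at least [kap], just
    to the left. *)
Context {R : realType} (D be r c a b T M kap : R) (y : R -> R -> R) (psi : R -> R) (ya : R).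
Hypotheses (D0 : 0 < D) (r0 : 0 < r) (c0 : 0 < c) (ab : a < b) (T0 : 0 < T) (kap0 : 0 < kap).
Hypothesis cy : {within `[a, +oo[ `*` `[0, T], continuous (fun z : R * R => y z.1 z.2)}.
Hypothesis yM : forall x t, a <= x -> 0 <= t <= T -> `|y x t| <= M.
Hypothesis super : forall x t, a < x -> 0 < t < T ->
  locally_subsol D be r (fun x t => - y x t) x t.
Hypothesis sub : forall x t, a < x -> 0 < t < T -> psi x < y x t ->
  locally_subsol D be r y x t.
Hypothesis obst : forall x t, a < x -> 0 < t <= T -> psi x <= y x t.
Hypothesis yl : forall t, 0 <= t <= T -> y a t = ya.
Hypothesis y0 : forall x, a < x -> y x 0 = psi x.
Hypothesis psi_c : forall x, b <= x -> psi x = c.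
Hypothesis psi_kink : forall x, b - 1 <= x <= b -> c + kap * (b - x) <= psi x.

(** * Monotonicity in time, spreading and persistence of contact *)

Lemma y_continuous_at x t e : a <= x -> 0 <= t <= T -> 0 < e ->
  exists2 d, 0 < d & forall u s, a <= u -> 0 <= s <= T -> `|u - x| < d -> `|s - t| < d ->
    `|y u s - y x t| < e.
Proof.
move=> ax tin e0; have Ext : (`[a, +oo[ `*` `[0, T]) (x, t) by rewrite /= !in_itv/= ax tin.
have /subspace_continuousP/(_ _ Ext)/cvgrPdist_lt/(_ e e0) := cy.
rewrite near_withinE => /nbhs_ballP [d /= d0 H]; exists d => // u s au sin ux st.
rewrite distrC; apply: (H (u, s)) => /=; first by split; rewrite /ball/= distrC.
by rewrite !in_itv/= au sin.
Qed.

Lemma y_difference_continuous xl s0 s1 h : a <= xl -> 0 <= s0 -> s1 + h <= T -> 0 <= h ->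
  {within `[xl, +oo[ `*` `[s0, s1],
    continuous (fun z : R * R => y z.1 z.2 + - y z.1 (z.2 + h))}.
Proof.
move=> al s00 s1T h0; apply/subspace_continuousP => -[x t] /=.
rewrite !in_itv/= => -[/andP[xlx _] /andP[s0t ts1]].
apply/cvgrPdist_lt => e e0; have e20 : 0 < e / 2 by rewrite divr_gt0.
have ax : a <= x by lra.
have [|d1 d10 H1] := @y_continuous_at x t _ ax _ e20; first by lra.
have [|d2 d20 H2] := @y_continuous_at x (t + h) _ ax _ e20; first by lra.
rewrite near_withinE; apply/nbhs_ballP; exists (Num.min d1 d2) => /=.
  by rewrite lt_min d10.
move=> [u v] [/=]; rewrite /ball/= !lt_min distrC => /andP[u1 u2].
rewrite distrC => /andP[v1 v2]; rewrite !in_itv/= => -[/andP[xlu _] /andP[s0v vs1]].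
have E1 : `|y u v - y x t| < e / 2 by apply: H1 => //; lra.
have E2 : `|y u (v + h) - y x (t + h)| < e / 2.
  by apply: H2 => //; [lra|lra|rewrite opprD addrACA subrr addr0].
change (`|(y x t - y x (t + h)) - (y u v - y u (v + h))| < e).
by move: E1 E2; rewrite !ltr_norml; lra.
Qed.

(** Where [y x t] exceeds [y x (t + h)] it exceeds [psi x], so the earlier copy is a subsolution
    exactly where the comparison asks for it, while minus the later copy is one everywhere. The
    initial inequality is the obstacle condition. *)
Lemma y_monotone x s t : a <= x -> 0 <= s <= t -> t <= T -> y x s <= y x t.
Proof.
move=> ax /andP[s0 st] tT.
have [->//|xa] := eqVneq x a.
  by rewrite !yl// ?s0 ?(le_trans s0 st)// ?(le_trans st tT).
have {xa ax} ax : a < x by rewrite lt_neqAle eq_sym xa.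
move: st; rewrite le_eqVlt => /orP[/eqP<-//|lt_st].
have [s0E|sn0] := eqVneq s 0.
  by rewrite s0E y0//; apply: obst => //; rewrite -s0E lt_st.
have {sn0}s_gt0 : 0 < s by rewrite lt_neqAle eq_sym sn0.
pose h := t - s.
have h0 : 0 < h by rewrite subr_gt0.
have Th : 0 < T - h by rewrite /h; lra.
rewrite -subr_le0.
pose w (x t : R) := y x t + - y x (t + h).
have -> : y x s - y x t = w x s by rewrite /w /h; congr (_ - y x _); ring.
apply: (@halfline_comparison R D be r w a 0 (T - h) 0 (M + M)) => //.
- by apply: y_difference_continuous => //; lra.
- move=> u v au /andP[v0 vT].
  have := yM au (t := v); have := yM au (t := v + h).
  rewrite v0 !ler_norml /w => H1 H2.
  have := H1; have := H2.
  have -> : v <= T by lra.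
  have -> : 0 <= v + h <= T by lra.
  move=> /(_ isT) ? /(_ isT) ?; lra.
- move=> v /andP[v0 vT]; rewrite /w !yl ?subrr//; first by lra.
  by rewrite v0; lra.
- move=> u au; rewrite /w add0r.
  have [->|ua] := eqVneq u a; first by rewrite !yl ?subrr ?lexx ?(ltW T0)//; lra.
  have {}ua : a < u by rewrite lt_neqAle eq_sym ua.
  by rewrite y0// subr_le0; apply: obst => //; lra.
- move=> u v au /andP[v0 vT] wuv; apply: locally_subsolD.
    apply: sub => //; first by rewrite v0; lra.
    apply: (@le_lt_trans _ _ (y u (v + h))); first by apply: obst => //; lra.
    by move: wuv; rewrite /w; lra.
  by apply: (@locally_subsol_shift _ D be r (fun x t => - y x t)); apply: super => //; lra.
- exact: ltW.
- by rewrite s0 /h; lra.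
Qed.

Lemma y_ge_c x t : b <= x -> 0 <= t <= T -> c <= y x t.
Proof.
move=> bx /andP[t0 tT]; have ax : a < x := lt_le_trans ab bx.
rewrite -(psi_c bx); have [->|tn0] := eqVneq t 0; first by rewrite y0.
by apply: obst => //; rewrite tT andbT lt_neqAle eq_sym tn0.
Qed.

(** Comparison with the constant [c] on the half-line from [x0]: monotonicity in time gives y <= c
    on its lateral side, the initial condition gives equality at time 0. *)
Lemma contact_right x0 t0 : b <= x0 -> 0 < t0 <= T -> y x0 t0 = c ->
  forall x t, x0 <= x -> 0 <= t <= t0 -> y x t = c.
Proof.
move=> bx0 /andP[t00 t0T] yc x t x0x /andP[tge0 tt0].
have ax0 : a <= x0 := ltW (lt_le_trans ab bx0).
apply/eqP; rewrite eq_le y_ge_c; [|lra|lra]; rewrite andbT.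
apply: (@halfline_comparison R D be r y x0 0 t0 c M) => //; last by rewrite tge0.
- exact: ltW.
- apply: continuous_subspaceW cy => -[u v] [/=]; rewrite !in_itv/= !andbT => h1 /andP[-> h2].
  by split; lra.
- move=> u v x0u /andP[v0 vt0]; apply: le_trans (ler_norm _) _; apply: yM; lra.
- by move=> v /andP[v0 vt0]; rewrite -yc; apply: y_monotone => //; lra.
- by move=> u x0u; rewrite y0 ?psi_c ?(le_trans bx0 x0u)// (lt_le_trans ab (le_trans bx0 x0u)).
- move=> u v x0u vin cy'; have bu := le_trans bx0 (ltW x0u).
  by apply: sub; rewrite ?psi_c// ?(lt_le_trans ab bu)//; lra.
Qed.

Lemma contact_persists x1 eta t0 : 0 < eta -> b <= x1 - eta -> 0 <= t0 < T ->
  (forall x, `|x - x1| <= eta -> y x t0 = c) ->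
  exists2 tau, 0 < tau & t0 + tau <= T /\ forall t, t0 <= t <= t0 + tau -> y x1 t = c.
Proof.
move=> eta0 bx1 /andP[t00 t0T] yc.
have ab' := ab; have D0' := D0; pose L := 2 * D + 2 * `|be| * eta.
have nb : 0 <= `|be| * eta by rewrite mulr_ge0// ltW.
have L0 : 0 < L by rewrite /L; lra.
(* [L] bounds what diffusion and drift of the parabola cost per unit of [k]; this [k] lets r c pay
   for it. *)
pose k := r * c / L.
have k0 : 0 < k by rewrite divr_gt0// mulr_gt0.
have kL : k * L = r * c by rewrite /k; field; rewrite gt_eqF.
have ke : 0 < k * eta ^+ 2 by rewrite mulr_gt0// exprn_gt0.
(* At x1 - eta and x1 + eta the parabola is k eta^2 above [c], so continuity leaves a positive time
   before [y] can reach it. At the centre the parabola equals [c]. *)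
have [||d1 d10 H1] := @y_continuous_at (x1 - eta) t0 _ _ _ ke; [lra|lra|].
have [||d2 d20 H2] := @y_continuous_at (x1 + eta) t0 _ _ _ ke; [lra|lra|].
have [tau tau0 [td1 td2 tT]] : exists2 tau, 0 < tau &
    [/\ tau <= d1 / 2, tau <= d2 / 2 & tau <= T - t0].
  exists (Num.min (Num.min (d1 / 2) (d2 / 2)) (T - t0)).
    by rewrite !lt_min !divr_gt0// subr_gt0.
  by split; rewrite !ge_min lexx ?orbT.
exists tau => //; split; first by lra.
move=> t tin; apply/eqP; rewrite eq_le y_ge_c; [|lra|lra]; rewrite andbT.
have CS := C21_quadratic c k x1 0 0 0.
have -> : c = c + 0 * (x1 - x1) + k * (x1 - x1) ^+ 2 + 0 * (t - 0) ^+ 2 by ring.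
have SE u s : c + 0 * (u - x1) + k * (u - x1) ^+ 2 + 0 * (s - 0) ^+ 2 = c + k * (u - x1) ^+ 2.
  by ring.
have t01 : t0 < t0 + tau by lra.
apply: (max_principle (be := be) (xl := x1 - eta) (xr := x1 + eta) D0 r0 t01 CS) => //.
- apply: continuous_subspaceW cy => -[u v] [/=]; rewrite !in_itv/= !andbT => h1 h2.
  by split; lra.
- move=> u s uin _; rewrite SE.
  have -> : 2 * 0 * (s - 0) - D * (2 * k) - be * (0 + 2 * k * (u - x1))
      + r * (c + k * (u - x1) ^+ 2) =
    r * k * (u - x1) ^+ 2 + 2 * k * (`|be| * eta - be * (u - x1)).
    by rewrite [r * (c + _)]mulrDr -kL /L; ring.
  rewrite addr_ge0//; first by rewrite mulr_ge0 ?sqr_ge0// mulr_ge0// ltW.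
  rewrite mulr_ge0//; first by rewrite mulr_ge0// ltW.
  by rewrite subr_ge0 (le_trans (ler_norm _))// normrM ler_wpM2l// ler_norml; lra.
- move=> s sin; rewrite SE.
  have : `|y (x1 - eta) s - y (x1 - eta) t0| < k * eta ^+ 2.
    apply: H1; [lra|lra|by rewrite subrr normr0|rewrite ger0_norm; lra].
  rewrite (yc (x1 - eta)); last by rewrite addrAC subrr add0r normrN ger0_norm// ltW.
  have -> : x1 - eta - x1 = - eta by ring.
  by rewrite sqrrN ltr_norml; lra.
- move=> s sin; rewrite SE.
  have : `|y (x1 + eta) s - y (x1 + eta) t0| < k * eta ^+ 2.
    apply: H2; [lra|lra|by rewrite subrr normr0|rewrite ger0_norm; lra].
  rewrite (yc (x1 + eta)); last by rewrite addrAC subrr add0r ger0_norm// ltW.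
  have -> : x1 + eta - x1 = eta by ring.
  by rewrite ltr_norml; lra.
- move=> u uin; rewrite SE yc; last by rewrite ler_norml; lra.
  by rewrite lerDl mulr_ge0 ?sqr_ge0// ltW.
- move=> u s uin sin; rewrite SE => cyu; apply: sub; [lra|lra|].
  rewrite psi_c; last lra.
  apply: le_lt_trans cyu.
  by rewrite lerDl mulr_ge0 ?sqr_ge0// ltW.
- lra.
Qed.

(* The kink is touched from below at [(x0, t0)] by functions with arbitrarily
   large second derivative [2 * N], contradicting the supersolution property. *)
Lemma no_kink x0 t0 k g d : b <= x0 -> 0 < t0 < T -> 0 < k -> 0 <= g -> 0 < d ->
  y x0 t0 = c ->
  (forall x t, x <= x0 -> `|x - x0| <= d -> `|t - t0| <= d ->
     c + k * (x0 - x) - g * (t - t0) ^+ 2 <= y x t) -> False.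
Proof.
move=> bx0 t0in k0 g0 d0 yc H.
(* Makes the operator of the test function at least 1 at [(x0, t0)]. *)
pose N := (`|be| * k / 2 + r * c + 1) / (2 * D).
have nb : 0 <= `|be| * k by rewrite mulr_ge0// ltW.
have rc : 0 < r * c by rewrite mulr_gt0.
have N0 : 0 < N by rewrite divr_gt0 ?mulr_gt0//; lra.
have DN : 2 * D * N = `|be| * k / 2 + r * c + 1.
  by rewrite /N mulrC divfK// gt_eqF// mulr_gt0.
(* The parabola leaves [x0] with slope k / 2, halfway between the two sides of the kink; N e <= k /
   2 keeps its quadratic term below the gap on either side. *)
pose e := Num.min (Num.min d (k / (2 * N))) (Num.min (t0 / 2) (T - t0)).
have e0 : 0 < e.
  by case/andP: t0in => t00 t0T; rewrite !lt_min d0 subr_gt0 t0T !divr_gt0// mulr_gt0.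
have [ed eN et eT] : [/\ e <= d, e <= k / (2 * N), e <= t0 / 2 & e <= T - t0].
  by split; rewrite /e !ge_min lexx ?orbT.
have {}eN : N * e <= k / 2.
  have h : e * (2 * N) <= k by rewrite -ler_pdivlMr// mulr_gt0.
  by rewrite ler_pdivlMr// (_ : N * e * 2 = e * (2 * N))//; ring.
have ax0 : a < x0 := lt_le_trans ab bx0.
have := @subsol_touching R D be r _ _ _ _ _ x0 t0 e D0 r0 (super ax0 t0in)
  (C21_quadratic (- c) (- N) x0 (k / 2) g t0) e0.
rewrite yc !subrr.
have sgn : be * k <= `|be| * k by rewrite ler_pM2r// ler_norm.
have F : 2 * g * 0 - D * (2 * - N) - be * (k / 2 + 2 * - N * 0) + r * - c <= 0 -> False.
  have -> : 2 * g * 0 - D * (2 * - N) - be * (k / 2 + 2 * - N * 0) + r * - c =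
    2 * D * N - be * k / 2 - r * c by field.
  by rewrite DN; lra.
move=> W; apply: F; apply: W => x t xe te.
have -> : - c - (- c + k / 2 * 0 + - N * 0 ^+ 2 + g * 0 ^+ 2) = 0.
  by rewrite expr0n /=; ring.
have [x0x|/ltW xx0] := leP x0 x.
  have yge : c <= y x t by apply: y_ge_c; [lra|move: te; rewrite ler_norml; lra].
  have h1 : 0 <= g * (t - t0) ^+ 2 by rewrite mulr_ge0 ?sqr_ge0.
  have h2 : 0 <= (x - x0) * (k / 2 - N * (x - x0)).
    rewrite mulr_ge0 ?subr_ge0//; apply: le_trans eN; rewrite ler_pM2l//.
    by apply: le_trans xe; rewrite ler_norm.
  by move: h2; rewrite mulrBr expr2; lra.
have := H x t xx0 (le_trans xe ed) (le_trans te ed).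
have h2 : 0 <= (x0 - x) * (k / 2 - N * (x0 - x)).
  rewrite mulr_ge0 ?subr_ge0//; apply: le_trans eN; rewrite ler_pM2l//.
  by apply: le_trans xe; rewrite distrC ler_norm.
have -> : (x - x0) ^+ 2 = (x0 - x) * (x0 - x) by ring.
by move: h2; rewrite mulrBr; lra.
Qed.

(** On a noncontact strip, [y] minus its shift is a subsolution. It is nonpositive on the lateral
    sides, where the barrier [decay] vanishes, so a positive increment at the centre can decay at
    most exponentially. *)
Lemma forward_positive x1 eta t0 te h e : 0 < eta -> b <= x1 - eta ->
  0 <= t0 -> t0 < te -> 0 < h -> te + h <= T -> 0 < e ->
  (forall x t, `|x - x1| < eta -> t0 < t < te -> c < y x t) ->
  (forall x, `|x - x1| <= eta -> e <= y x (t0 + h) - y x t0) ->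
  exists2 e', 0 < e' & forall t, t0 <= t <= te -> e' <= y x1 (t + h) - y x1 t.
Proof.
move=> eta0 bx1 t00 t0e h0 teT e0 nc We.
have ax1 : a < x1 - eta := lt_le_trans ab bx1.
pose N := decay_rate D be r eta.
(* Normalises the profile to the value [e] at its centre. *)
pose e1 := e / eta ^+ 2 ^+ 2.
have eta4 : 0 < eta ^+ 2 ^+ 2 by rewrite !exprn_gt0.
have e10 : 0 < e1 by rewrite divr_gt0.
have e1E : e1 * eta ^+ 2 ^+ 2 = e by rewrite /e1 divfK// gt_eqF.
have NE : N = decay_rate D be r eta by [].
have S0 u s : decay e1 N x1 eta t0 u s <= 0.
  by rewrite oppr_le0 mulr_ge0 ?expR_ge0// mulr_ge0 ?sqr_ge0// ltW.
have incr u s : a <= u -> t0 <= s <= te -> y u s + - y u (s + h) <= 0.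
  move=> au sin; rewrite subr_le0; apply: y_monotone => //; first by clear NE; lra.
  by clear NE; lra.
have key t : t0 <= t <= te -> y x1 t + - y x1 (t + h) <= decay e1 N x1 eta t0 x1 t.
  move=> tin; apply: (@max_principle R D be r (fun x t => y x t + - y x (t + h)) _ _ _ _
    (x1 - eta) (x1 + eta) t0 te D0 r0 t0e (C21_decay e1 N x1 eta t0)) => //.
  - have := @y_difference_continuous (x1 - eta) t0 te h (ltW ax1) t00 teT (ltW h0).
    apply: continuous_subspaceW => -[u v] [/=]; rewrite !in_itv/= !andbT.
    by move=> /andP[-> _] ->.
  - by move=> u s uin sin; exact: decay_supersol NE D0 (ltW e10) eta0 uin.
  - move=> s sin; rewrite /decay (_ : x1 - eta - x1 = - eta); last by ring.
    by rewrite sqrrN subrr expr0n /= mulr0 mul0r oppr0; apply: incr => //; exact: ltW.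
  - move=> s sin; rewrite /decay (_ : x1 + eta - x1 = eta); last by ring.
    by rewrite subrr expr0n /= mulr0 mul0r oppr0; apply: incr => //; clear NE; lra.
  - move=> u uin; have uin' : `|u - x1| <= eta by rewrite ler_norml; clear NE; lra.
    apply: (@le_trans _ _ (- e)); first by have := We u uin'; clear NE; lra.
    rewrite lerN2 subrr mulr0 expR0 mulr1 -e1E ler_pM2l//.
    have u2 : (u - x1) ^+ 2 <= eta ^+ 2.
      by rewrite -(real_normK (num_real (u - x1))) lerXn2r// ?nnegrE// ltW.
    rewrite lerXn2r ?nnegrE ?sqr_ge0 ?subr_ge0//.
    by rewrite gerDl oppr_le0 sqr_ge0.
  - move=> u s uin sin wgt.
    have au : a < u by clear NE; lra.
    have bu : b <= u by clear NE; lra.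
    apply: locally_subsolD.
      apply: sub => //; first by clear NE; lra.
      by rewrite psi_c//; apply: nc => //; rewrite ltr_norml; clear NE; lra.
    apply: (@locally_subsol_shift _ D be r (fun x t => - y x t)).
    by apply: super => //; clear NE; lra.
  - by clear NE; lra.
have N0 : 0 <= N.
  rewrite /N /decay_rate addr_ge0 ?(ltW r0)// divr_ge0 ?sqr_ge0//.
  by rewrite mulr_ge0 ?sqr_ge0// mulr_ge0 ?(ltW D0).
exists (e * expR (- N * (te - t0))); first by rewrite mulr_gt0// expR_gt0.
move=> t tin; have := key t tin.
rewrite /decay subrr expr0n /= subr0 e1E.
have : e * expR (- N * (te - t0)) <= e * expR (- N * (t - t0)).
  rewrite ler_pM2l// ler_expR !mulNr lerN2 ler_wpM2l//; clear NE; lra.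
by clear NE; lra.
Qed.

(** A quantitative Hopf lemma: the linear growth away from [x0], up to a quadratic loss in time, is
    the form in which [no_kink] expects it. *)
Lemma hopf_lower x1 x0 t0 th h e : x1 < x0 -> b <= x1 -> 0 <= t0 - th -> 0 < th ->
  0 < h -> t0 + th + h <= T -> 0 < e ->
  (forall x t, x1 < x < x0 -> `|t - t0| < th -> c < y x t) ->
  (forall t, `|t - t0| <= th -> e <= y x1 (t + h) - y x1 t) ->
  exists k g, [/\ 0 < k, 0 <= g & forall x t, x1 <= x <= x0 -> `|t - t0| <= th ->
    k * (x0 - x) - g * (t - t0) ^+ 2 <= y x (t + h) - y x t].
Proof.
move=> x10 bx1 t0th th0 h0 thT e0 nc We.
have ax1 : a < x1 := lt_le_trans ab bx1.
(* The parabola with vertex [(x0, t0)] meets the side [x1] exactly at the times t0 - th and t0 + th.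
   On the initial and right sides of the rectangle, monotonicity in time then suffices. *)
pose g := (x0 - x1) / th ^+ 2.
have th2 : 0 < th ^+ 2 by rewrite exprn_gt0.
have g0 : 0 <= g by rewrite divr_ge0 ?(ltW th2)// subr_ge0 ltW.
have gE : g * th ^+ 2 = x0 - x1 by rewrite /g divfK// gt_eqF.
pose lam := (2 * g * th + `|be| + r) / D + 1.
have lam0 : 0 < lam.
  rewrite ltr_pwDr// divr_ge0 ?(ltW D0)// addr_ge0 ?(ltW r0)// addr_ge0//.
  by rewrite mulr_ge0 ?(ltW th0)// mulr_ge0.
have E0 := expR_gt0 (lam * (x0 - x1)).
(* Keeps the increment demanded on the side [x1] below [e]. *)
pose e1 := e / expR (lam * (x0 - x1)).
have e10 : 0 < e1 by rewrite divr_gt0.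
have e1E : e1 * expR (lam * (x0 - x1)) = e by rewrite /e1 divfK// gt_eqF.
have incr u s : a <= u -> t0 - th <= s <= t0 + th -> y u s + - y u (s + h) <= 0.
  by move=> au sin; rewrite subr_le0; apply: y_monotone => //; lra.
have hge u s : (x0 - u) - g * (s - t0) ^+ 2 <= 0 -> 0 <= hopf e1 lam g x0 t0 u s.
  move=> le0; rewrite /hopf -{1}[e1]mulr1 -mulrBr mulr_ge0 ?(ltW e10)// subr_ge0.
  by rewrite -expR0 ler_expR mulr_ge0_le0// ltW.
have tlt : t0 - th < t0 + th by lra.
have sq0 s : 0 <= g * (s - t0) ^+ 2 by rewrite mulr_ge0 ?sqr_ge0.
have key x t : x1 <= x <= x0 -> t0 - th <= t <= t0 + th ->
    y x t + - y x (t + h) <= hopf e1 lam g x0 t0 x t.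
  move=> xin tin; apply: (@max_principle R D be r (fun x t => y x t + - y x (t + h)) _ _ _ _
    x1 x0 (t0 - th) (t0 + th) D0 r0 tlt (C21_hopf e1 lam g x0 t0)) => //.
  - have := @y_difference_continuous x1 (t0 - th) (t0 + th) h (ltW ax1) t0th thT (ltW h0).
    apply: continuous_subspaceW => -[u v] [/=]; rewrite !in_itv/= !andbT.
    by move=> /andP[-> _] ->.
  - move=> u s uin sin; apply: (@hopf_supersol R D be r e1 g th x0 t0 u s lam) => //.
      exact: ltW.
    by rewrite ler_norml; lra.
  - move=> s sin; apply: (@le_trans _ _ (- e)).
      have sin' : `|s - t0| <= th by rewrite ler_norml; lra.
      by have := We s sin'; lra.
    rewrite /hopf; have : e1 * expR (lam * (x0 - x1 - g * (s - t0) ^+ 2)) <= e.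
      rewrite -e1E ler_pM2l// ler_expR ler_pM2l// gerDl oppr_le0; exact: sq0.
    lra.
  - move=> s sin; apply: le_trans (hge _ _ _); first by apply: incr => //; lra.
    by rewrite subrr sub0r oppr_le0; exact: sq0.
  - move=> u uin; apply: le_trans (hge _ _ _); first by apply: incr => //; lra.
    rewrite (_ : t0 - th - t0 = - th); last by ring.
    by rewrite sqrrN gE; lra.
  - move=> u s uin sin wgt.
    have au : a < u by lra.
    have bu : b <= u by lra.
    apply: locally_subsolD.
      apply: sub => //; first by lra.
      by rewrite psi_c//; apply: nc => //; rewrite ltr_norml; lra.
    by apply: (@locally_subsol_shift _ D be r (fun x t => - y x t)); apply: super => //; lra.
exists (e1 * lam), (e1 * lam * g); split; first exact: mulr_gt0.
  by apply: mulr_ge0 => //; apply: mulr_ge0; exact: ltW.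
move=> x t xin tin; have tin' : t0 - th <= t <= t0 + th by move: tin; rewrite ler_norml; lra.
have := key x t xin tin'; rewrite /hopf.
(* Bounding the exponential below by its tangent yields the linear estimate, with k = e1 lam. *)
have H : e1 * (1 + lam * (x0 - x - g * (t - t0) ^+ 2)) <=
    e1 * expR (lam * (x0 - x - g * (t - t0) ^+ 2)).
  by rewrite ler_pM2l//; exact: expR_ge1Dx.
move: H; rewrite mulrDr mulr1.
have -> : e1 * lam * (x0 - x) - e1 * lam * g * (t - t0) ^+ 2 =
  e1 * (lam * (x0 - x - g * (t - t0) ^+ 2)) by ring.
lra.
Qed.

(** * Monotonicity, one-sided continuity and strictness of the free boundary *)

Variable A : R -> R.
Hypothesis A_contact : forall t, 0 < t <= T -> b <= A t /\ y (A t) t = c.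
Hypothesis A_min : forall t x, 0 < t <= T -> b <= x -> y x t = c -> A t <= x.

Lemma A_monotone s t : 0 < s -> s <= t -> t <= T -> A s <= A t.
Proof.
move=> s0 st tT; have tin : 0 < t <= T by rewrite tT (lt_le_trans s0 st).
have [bA yc] := A_contact tin.
apply: A_min => //; first by rewrite s0 (le_trans st tT).
by apply: (contact_right bA tin yc) => //; rewrite ltW.
Qed.

Lemma noncontact x t : 0 < t <= T -> b <= x -> x < A t -> c < y x t.
Proof.
move=> tin bx xA; rewrite lt_neqAle y_ge_c//; last by case/andP: tin => /ltW -> ->.
rewrite andbT; apply/eqP => yc; move: xA; rewrite ltNge A_min//.
Qed.

(** If A s = b, the obstacle itself would provide a kink of slope [kap] at [(b, s)], constant in
    time. *)
Lemma A_gt_b t : 0 < t <= T -> b < A t.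
Proof.
have H s : 0 < s < T -> b < A s.
  move=> /andP[s0 sT]; have sin : 0 < s <= T by rewrite s0 ltW.
  have [bA yc] := A_contact sin; rewrite lt_neqAle bA andbT; apply/eqP => bE.
  rewrite -bE in yc.
  pose d := Num.min (Num.min 1 ((b - a) / 2)) (Num.min (s / 2) (T - s)).
  have d0 : 0 < d by rewrite !lt_min ltr01 !divr_gt0 ?subr_gt0.
  have [d1 d2 d3 d4] : [/\ d <= 1, d <= (b - a) / 2, d <= s / 2 & d <= T - s].
    by split; rewrite /d !ge_min lexx ?orbT.
  apply: (@no_kink b s kap 0 d) => //; first by rewrite s0.
  have ab' := ab; move=> x u xb; rewrite !ler_norml mul0r subr0 => xd ud.
  apply: (@le_trans _ _ (psi x)); first by apply: psi_kink; lra.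
  by apply: obst; lra.
(* The kink argument needs times after as well as before; the final time [T] is reached through t /
   2 and monotonicity. *)
move=> /andP[t0 tT].
apply: (@lt_le_trans _ _ (A (t / 2))); first by apply: H; lra.
by apply: A_monotone => //; lra.
Qed.

(** Persistence needs contact on both sides of a point, hence the shift by [e]. A free [x0] in place
    of [A t0] covers time 0, with x0 = b. *)
Lemma A_right t0 x0 e : 0 <= t0 < T -> b <= x0 -> 0 < e ->
  (forall x, x0 <= x -> y x t0 = c) ->
  exists2 tau, 0 < tau & forall t, t0 < t <= t0 + tau -> t <= T /\ A t <= x0 + e.
Proof.
move=> t0in bx0 e0 yc.
have bx : b <= x0 + e - e by rewrite addrK.
have ycx x : `|x - (x0 + e)| <= e -> y x t0 = c.
  by move=> xe; apply: yc; move: xe; rewrite ler_norml; lra.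
have [tau tau0 [tT H]] := contact_persists e0 bx t0in ycx.
exists tau => // t tin; case/andP: t0in => t00 t0T; split; first by lra.
apply: A_min; [lra|lra|].
by apply: H; lra.
Qed.

(** A value [A t] below A t0 - e would spread contact to the point A t0 - e at time [t]; by
    continuity of [y] this is impossible for [t] close to [t0], where that point is noncontact. *)
Lemma A_left t0 e : 0 < t0 <= T -> 0 < e ->
  exists2 tau, 0 < tau & forall t, 0 < t -> t0 - tau < t <= t0 -> A t0 - e < A t.
Proof.
move=> t0in e0; have /andP[t00 t0T] := t0in.
(* Below [b] the bound is automatic, whatever [tau] is. *)
have [ltb|bx] := ltP (A t0 - e) b.
  exists 1 => // t tgt0 tin; apply: lt_le_trans ltb _.
  by have [|] := A_contact (t := t) _; lra.
have nc : c < y (A t0 - e) t0 by apply: noncontact => //; lra.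
have aA : a <= A t0 - e by exact: ltW (lt_le_trans ab bx).
have t0in' : 0 <= t0 <= T by lra.
have nc' : 0 < y (A t0 - e) t0 - c by rewrite subr_gt0.
have [d d0 H] := y_continuous_at aA t0in' nc'.
exists d => //.
move=> t tgt0 tin; rewrite ltNge; apply/negP => At.
have tin' : 0 < t <= T by lra.
have [bA yc] := A_contact tin'.
have E : y (A t0 - e) t = c by apply: (contact_right bA tin' yc) => //; lra.
have : `|y (A t0 - e) t - y (A t0 - e) t0| < y (A t0 - e) t0 - c.
  by apply: H; rewrite ?subrr ?normr0// ?ltr_norml; lra.
by rewrite E distrC ger0_norm ?subr_ge0 ?ltW// ltxx.
Qed.

(* Otherwise [A] would be constant on [(0, s]], contradicting its limit [b]. *)
Lemma A_increment s t h : 0 < s -> s < t -> t <= T -> 0 < h -> s + h <= t -> A s = A t ->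
  exists2 s', 0 < s' < s & A s' < A (s' + h).
Proof.
move=> s0 st tT h0 sht AE; apply: contrapT => nex.
have stay s' : 0 < s' < s -> A (s' + h) <= A s'.
  by move=> s'in; rewrite leNgt; apply/negP => lt; apply: nex; exists s'.
(* Steps of length [h], none of which raises [A], lead from any [u] to [s] in finitely many
   moves. *)
have const n : forall u, 0 < u -> u <= s -> s <= u + n%:R * h -> A s <= A u.
  elim: n => [|n IHn] u u0 us.
    by rewrite mul0r addr0 => su; rewrite (_ : u = s)//; apply/eqP; rewrite eq_le us.
  move=> su; have [->//|uns] := eqVneq u s.
  have {uns}us : u < s by rewrite lt_neqAle uns.
  apply: le_trans (stay u _); last by rewrite u0.
  have [uhs|suh] := leP (u + h) s.
    by apply: IHn => //; [lra|move: su; rewrite -natr1; lra].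
  by apply: A_monotone => //; [exact: ltW|lra].
have sin : 0 < s <= T by lra.
have bAs := A_gt_b sin.
have T00 : 0 <= (0 : R) < T by rewrite lexx.
have ye : 0 < (A s - b) / 2 by rewrite divr_gt0// subr_gt0.
have y0c x : b <= x -> y x 0 = c.
  by move=> bx; rewrite y0 ?psi_c// (lt_le_trans ab bx).
have [tau tau0 H] := A_right T00 (lexx b) ye y0c.
pose u := Num.min tau s.
have u0 : 0 < u by rewrite lt_min tau0.
have us : u <= s by rewrite ge_min lexx orbT.
have ut : u <= tau by rewrite ge_min lexx.
have [|_ Au] := H u; first by rewrite add0r u0.
have Asu : A s <= A u.
  pose n := Num.bound (s / h).
  apply: (const n) => //.
  have : s / h < n%:R by apply: le_lt_trans (archi_boundP _); rewrite ?divr_ge0// ltW.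
  by rewrite ltr_pdivrMr//; lra.
lra.
Qed.

(** At [A s] the increment is positive because contact at time [s] has been lost at time s + h.
    Continuity carries this to an interval on the left, which stays noncontact at later times since
    [A] is monotone. *)
Lemma increment_positive s te h : 0 < s -> s < te -> 0 < h -> te + h <= T ->
  A s < A (s + h) ->
  exists x1 e, [/\ b <= x1, x1 < A s, 0 < e &
    forall t, s <= t <= te -> e <= y x1 (t + h) - y x1 t].
Proof.
move=> s0 ste h0 teT Aincr.
have sin : 0 < s <= T by lra.
have shin : 0 < s + h <= T by lra.
have bA := A_gt_b sin; have [_ yc] := A_contact sin.
have aA : a < A s by exact: lt_trans ab bA.
have w00 : 0 < y (A s) (s + h) - y (A s) s.
  by rewrite subr_gt0 yc; apply: noncontact => //; exact: ltW.
move: w00; set w := y (A s) (s + h) - y (A s) s => w0.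
have w4 : 0 < w / 4 by rewrite divr_gt0.
have sin' : 0 <= s <= T by lra.
have shin' : 0 <= s + h <= T by lra.
have [d1 d10 H1] := y_continuous_at (ltW aA) sin' w4.
have [d2 d20 H2] := y_continuous_at (ltW aA) shin' w4.
(* The interval of radius [eta] about A s - 2 eta stays within 3 eta of [A s], strictly to its left
   and above [b]. *)
have [eta eta0 [e1 e2 e3]] : exists2 eta, 0 < eta &
    [/\ 4 * eta <= d1, 4 * eta <= d2 & 4 * eta <= A s - b].
  exists (Num.min (Num.min d1 d2) (A s - b) / 4).
    by rewrite divr_gt0// !lt_min d10 d20 subr_gt0.
  have E z : 4 * (z / 4) = z :> R by field.
  by rewrite E; split; rewrite !ge_min lexx ?orbT.
have w2 : 0 < w / 2 by rewrite divr_gt0.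
have bx1 : b <= (A s - 2 * eta) - eta by lra.
have nc x u : `|x - (A s - 2 * eta)| < eta -> s < u < te -> c < y x u.
  rewrite ltr_norml => /andP[x1 x2] /andP[u1 u2].
  apply: noncontact; [lra|lra|].
  apply: (@lt_le_trans _ _ (A s)); first by lra.
  by apply: A_monotone => //; [exact: ltW|lra].
have We x : `|x - (A s - 2 * eta)| <= eta -> w / 2 <= y x (s + h) - y x s.
  rewrite ler_norml => /andP[x1 x2].
  have ax : a <= x by move: (ltW ab) => ?; lra.
  have xd : `|x - A s| <= 3 * eta by rewrite ler_norml; lra.
  have g1 : `|y x s - y (A s) s| < w / 4.
    by apply: H1 => //; [apply: le_lt_trans xd _; lra|rewrite subrr normr0].
  have g2 : `|y x (s + h) - y (A s) (s + h)| < w / 4.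
    by apply: H2 => //; [apply: le_lt_trans xd _; lra|rewrite subrr normr0].
  have -> : y x (s + h) - y x s =
    w + (y x (s + h) - y (A s) (s + h)) - (y x s - y (A s) s) by rewrite /w; ring.
  move: g1 g2; rewrite !ltr_norml => /andP[_ g1] /andP[g2 _].
  by lra.
have [e e0 H] := forward_positive eta0 bx1 (ltW s0) ste h0 teT w2 nc We.
exists (A s - 2 * eta), e; split => //; lra.
Qed.

(** The kink arises at [(x0, t0 + h)], by adding the Hopf bound to y >= c at the earlier time; the
    plateau therefore has to cover the shifted window too. *)
Lemma no_plateau x0 x1 t0 th h e : 0 < t0 - th -> 0 < th -> 0 < h -> t0 + th + h <= T ->
  b <= x1 -> x1 < x0 -> 0 < e ->
  (forall t, `|t - t0| <= th -> e <= y x1 (t + h) - y x1 t) ->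
  (forall t, t0 - th <= t <= t0 + th + h -> A t = x0) -> False.
Proof.
move=> t0th th0 h0 thT bx1 x10 e0 We Ax0.
have nc x t : x1 < x < x0 -> `|t - t0| < th -> c < y x t.
  rewrite ltr_norml => /andP[x1x xx0] /andP[u1 u2].
  apply: noncontact; [lra|lra|].
  by rewrite Ax0//; lra.
have [k [g [k0 g0 lower]]] := hopf_lower x10 bx1 (ltW t0th) th0 h0 thT e0 nc We.
have bx0 : b <= x0 by lra.
have t0h : 0 < t0 + h < T by lra.
have d0 : 0 < Num.min th (x0 - x1) by rewrite lt_min th0 subr_gt0.
have yc : y x0 (t0 + h) = c.
  have t0h' : 0 < t0 + h <= T by lra.
  by have [_] := A_contact t0h'; rewrite Ax0//; lra.
apply: (no_kink bx0 t0h k0 g0 d0 yc) => x u xx0.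
rewrite !le_min => /andP[_ xd] /andP[ud _].
have x1x : x1 <= x by move: xd; rewrite ler_norml; lra.
have E : u - h - t0 = u - (t0 + h) by ring.
have := lower x (u - h); rewrite E subrK x1x xx0 => /(_ isT ud).
have : c <= y x (u - h).
  apply: y_ge_c; first exact: le_trans x1x.
  by move: ud; rewrite ler_norml => /andP[u1 u2]; lra.
lra.
Qed.

Lemma A_strict s t : 0 < s -> s < t -> t <= T -> A s < A t.
Proof.
move=> s0 st tT; rewrite lt_neqAle A_monotone ?(ltW st)// andbT; apply/eqP => AE.
(* Half of the plateau is the time shift, leaving the other half for the Hopf window. *)
have h0 : 0 < (t - s) / 2 by rewrite divr_gt0// subr_gt0.
have sht : s + (t - s) / 2 <= t by lra.
have [s' /andP[s'0 s's] Aincr] := A_increment s0 st tT h0 sht AE.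
have Ax0 u : s <= u <= t -> A u = A s.
  move=> /andP[su ut]; apply/eqP; rewrite eq_le; apply/andP; split.
    by rewrite AE; apply: A_monotone => //; lra.
  by apply: A_monotone => //; lra.
have [||x1 [e [bx1 x1A e0 We]]] := @increment_positive s' (t - (t - s) / 2) _ s'0 _ h0 _ Aincr.
- by lra.
- by lra.
have x1s : x1 < A s.
  by apply: lt_le_trans x1A _; apply: A_monotone => //; lra.
(* The window runs from s + (t - s) / 8 to s + 3 (t - s) / 8; after the shift it ends at s + 7 (t -
   s) / 8, before [t]. *)
apply: (@no_plateau (A s) x1 (s + (t - s) / 4) ((t - s) / 8) ((t - s) / 2) e) => //.
- lra.
- lra.
- lra.
- by move=> u; rewrite ler_norml => /andP[u1 u2]; apply: We; lra.
- by move=> u uin; apply: Ax0; lra.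
Qed.

(** * The limit at time 0 and the continuous extension *)

Lemma A_cvg0 : A s @[s --> 0^'+] --> b.
Proof.
apply/cvgrPdist_le => e e0.
have T00 : 0 <= (0 : R) < T by rewrite lexx.
have y0c x : b <= x -> y x 0 = c.
  by move=> bx; rewrite y0 ?psi_c// (lt_le_trans ab bx).
have [tau tau0 H] := A_right T00 (lexx b) e0 y0c.
near=> t.
have t0 : 0 < t by near: t; exact: nbhs_right_gt.
have tt : t <= tau by near: t; exact: nbhs_right_le.
have tin : 0 < t <= 0 + tau by rewrite add0r t0.
have [tT At] := H t tin.
have tin' : 0 < t <= T by rewrite t0.
have [bA _] := A_contact tin'.
by rewrite ler0_norm ?subr_le0//; lra.
Unshelve. all: by end_near. Qed.

Definition A_ext t := if t == 0 then b else A t.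

Lemma A_extE t : 0 < t -> A_ext t = A t.
Proof. by move=> t0; rewrite /A_ext gt_eqF. Qed.

Lemma A_ext_strict s t : 0 <= s -> s < t -> t <= T -> A_ext s < A_ext t.
Proof.
move=> s0 st tT; rewrite (A_extE (le_lt_trans s0 st)) /A_ext.
have [sE|sn0] := eqVneq s 0.
  by apply: A_gt_b; rewrite tT -sE st.
by apply: A_strict => //; rewrite lt_neqAle eq_sym sn0.
Qed.

(** Time 0 needs no separate argument: the initial condition is contact on the whole half-line from
    [b]. *)
Lemma A_ext_right t0 e : 0 <= t0 < T -> 0 < e ->
  exists2 tau, 0 < tau & forall t, t0 < t <= t0 + tau -> t <= T -> A_ext t <= A_ext t0 + e.
Proof.
move=> /andP[t00 t0T] e0; have t0in : 0 <= t0 < T by rewrite t00.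
have [bA yc] : b <= A_ext t0 /\ forall x, A_ext t0 <= x -> y x t0 = c.
  rewrite /A_ext; have [->|t0n0] := eqVneq t0 0.
    by split=> // x bx; rewrite y0 ?psi_c// (lt_le_trans ab bx).
  have t0in' : 0 < t0 <= T by rewrite (ltW t0T) lt_neqAle eq_sym t0n0 t00.
  have [bA yc] := A_contact t0in'; split=> // x Ax.
  by apply: (contact_right bA t0in' yc Ax); rewrite t00 lexx.
have [tau tau0 H] := A_right t0in bA e0 yc; exists tau => // t tin _.
have tgt0 : 0 < t by lra.
by rewrite (A_extE tgt0); have [] := H t tin.
Qed.

Lemma A_ext_left t0 e : 0 < t0 <= T -> 0 < e ->
  exists2 tau, 0 < tau & forall t, t0 - tau < t <= t0 -> A_ext t0 - e < A_ext t.
Proof.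
move=> t0in e0; have [tau tau0 H] := A_left t0in e0.
have /andP[t00 _] := t0in.
exists (Num.min tau t0); first by rewrite lt_min tau0.
move=> t /andP[tl tt0].
have m1 : Num.min tau t0 <= tau by rewrite ge_min lexx.
have m2 : Num.min tau t0 <= t0 by rewrite ge_min lexx orbT.
have tgt0 : 0 < t by lra.
by rewrite !A_extE//; apply: H => //; lra.
Qed.

Lemma A_ext_continuous : {within `[0, T], continuous A_ext}.
Proof.
apply/subspace_continuousP => t0; rewrite /= in_itv/= => t0in.
have mono s t : 0 <= s -> s <= t -> t <= T -> A_ext s <= A_ext t.
  move=> s0; rewrite le_eqVlt => /orP[/eqP->//|st] tT.
  exact/ltW/A_ext_strict.
apply/cvgrPdist_le => e e0.
have [r1 r10 R1] : exists2 tau, 0 < tau & forall t, t0 < t < t0 + tau -> t <= T ->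
    A_ext t <= A_ext t0 + e.
  have [t0T|Tt0] := ltP t0 T.
    have t0in' : 0 <= t0 < T by rewrite t0T; case/andP: t0in => ->.
    have [tau tau0 H] := A_ext_right t0in' e0; exists tau => // t tin tT.
    by apply: H => //; lra.
  by exists 1 => // t tin tT; lra.
have [r2 r20 R2] : exists2 tau, 0 < tau & forall t, t0 - tau < t < t0 -> 0 <= t ->
    A_ext t0 - e <= A_ext t.
  have [t00|t00] := ltP 0 t0.
    have t0in' : 0 < t0 <= T by rewrite t00; case/andP: t0in => _ ->.
    have [tau tau0 H] := A_ext_left t0in' e0; exists tau => // t tin _.
    by apply/ltW/H; lra.
  by exists 1 => // t tin tt; lra.
rewrite near_withinE; apply/nbhs_ballP; exists (Num.min r1 r2) => /=.
  by rewrite lt_min r10.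
move=> t; rewrite /ball/= lt_min => /andP[b1 b2]; rewrite in_itv/= => tin.
change (`|A_ext t0 - A_ext t| <= e).
have [tt0|tt0|->] := ltgtP t t0; last by rewrite subrr normr0 ltW.
- have h1 : A_ext t <= A_ext t0 by apply: mono; [lra|exact: ltW|lra].
  have h2 : A_ext t0 - e <= A_ext t.
    by apply: R2; move: b2; rewrite ltr_norml; lra.
  by rewrite ler_norml; lra.
- have h1 : A_ext t0 <= A_ext t by apply: mono; [lra|exact: ltW|lra].
  have h2 : A_ext t <= A_ext t0 + e.
    by apply: R1; move: b1; rewrite ltr_norml; lra.
  by rewrite ler_norml; lra.
Qed.

End ObstacleProblem.

(** * The payoff, and conclusion *)

Lemma psi2_right {R : realType} (K1 k2 K2 x : R) : 0 < K2 -> ln K2 <= x ->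
  psi2 K1 k2 K2 x = k2 - K1.
Proof.
move=> K20 K2x; rewrite /psi2.
have : K2 <= expR x by rewrite -[X in X <= _]lnK ?posrE// ler_expR.
by rewrite -subr_le0 => /max_idPr ->; rewrite add0r.
Qed.

(** With s = ln K2 - x in [0, 1], 1 - exp(-s) >= s exp(-s) >= s exp(-1); this is the origin of the
    slope K2 exp(-1). *)
Lemma psi2_kink {R : realType} (K1 k2 K2 x : R) : 0 < K2 -> ln K2 - 1 <= x <= ln K2 ->
  k2 - K1 + K2 * expR (-1) * (ln K2 - x) <= psi2 K1 k2 K2 x.
Proof.
move=> K20 /andP[x1 x2]; rewrite /psi2.
have : K2 - expR x <= Num.max (K2 - expR x) 0 by rewrite le_max lexx.
suff : K2 * expR (-1) * (ln K2 - x) <= K2 - expR x by lra.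
pose s := ln K2 - x.
have s0 : 0 <= s by rewrite /s; lra.
have -> : expR x = K2 * expR (- s).
  by rewrite -[X in X * _]lnK ?posrE// -expRD; congr expR; rewrite /s; ring.
have h1 : expR (-1) <= expR (- s) by rewrite ler_expR /s; lra.
have h2 : expR (- s) * (1 + s) <= 1.
  have E : expR (- s) * expR s = 1 by rewrite -expRD addNr expR0.
  by rewrite -[X in _ <= X]E ler_pM2l ?expR_gt0//; exact: expR_ge1Dx.
have h3 : expR (-1) * s <= expR (- s) * s by rewrite ler_wpM2r.
rewrite -/s -mulrA -[X in _ <= X - _]mulr1 -mulrBr ler_pM2l//.
by move: h2 h3; rewrite mulrDr mulr1; clear; lra.
Qed.

Theorem theorem4p7 (R : realType) (K1 k1 k2 K2 sigma r q T : R)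
  (K1_gt0 : 0 < K1) (lt_K1_k1 : K1 < k1) (lt_k1_k2 : k1 < k2)
  (lt_k2_K2 : k2 < K2)
  (sigma_gt0 : 0 < sigma) (r_gt0 : 0 < r) (q_ge0 : 0 <= q) (T_gt0 : 0 < T)
  (p : R) (p_gt1 : 1 < p) (Y : R * R -> R)
  (solY : strong_solution K1 k2 K2 sigma r q T p Y)
  (bndY : bounded_on_Q k2 T Y)
  (A : R -> R) (minA : outer_free_boundary K1 k2 K2 T Y A) :
  [/\ {in `[0, T] &, {homo extend_at0 A : s t / s < t}},
      {within `[0, T], continuous (extend_at0 A)},
      A s @[s --> 0^'+] --> ln K2 &
      extend_at0 A 0 = ln K2].
Proof.
have D0 : 0 < sigma ^+ 2 / 2 by rewrite divr_gt0// exprn_gt0.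
have k20 : 0 < k2 by lra.
have K20 : 0 < K2 by lra.
have c0 : 0 < k2 - K1 by lra.
have ab : ln k2 < ln K2 by rewrite ltr_ln ?posrE.
have kap0 : 0 < K2 * expR (-1) by rewrite mulr_gt0// expR_gt0.
have [M YM] := bndY.
have [Yx [Yxx [Yt [[cY _ _ _ _] obst _ _ [Y0 Yl]]]]] := solY.
pose y x t := Y (x, t).
have yE : (fun z : R * R => y z.1 z.2) = Y by apply/funext => -[].
have cy : {within `[ln k2, +oo[ `*` `[0, T], continuous (fun z : R * R => y z.1 z.2)}.
  by rewrite yE.
have yM x t : ln k2 <= x -> 0 <= t <= T -> `|y x t| <= M.
  by move=> ax tin; apply: YM; rewrite /domQ_cl /= !in_itv/= ax tin.
have yobst x t : ln k2 < x -> 0 < t <= T -> psi2 K1 k2 K2 x <= y x t.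
  by move=> ax tin; apply: (obst (x, t)); rewrite /domQ /= !in_itv/= ax tin.
have ysuper x t := strong_solution_super solY (x0 := x) (t0 := t).
have ysub x t := strong_solution_sub solY (x0 := x) (t0 := t).
have A_contact t : 0 < t <= T -> ln K2 <= A t /\ y (A t) t = k2 - K1.
  by move=> /minA [].
have A_min t x : 0 < t <= T -> ln K2 <= x -> y x t = k2 - K1 -> A t <= x.
  by move=> /minA [_ lb] bx yc; exact: lb.
have psic x : ln K2 <= x -> psi2 K1 k2 K2 x = k2 - K1 by exact: psi2_right.
have psik x : ln K2 - 1 <= x <= ln K2 ->
    k2 - K1 + K2 * expR (-1) * (ln K2 - x) <= psi2 K1 k2 K2 x by exact: psi2_kink.
have cvgA : A s @[s --> 0^'+] --> ln K2.
  exact: (A_cvg0 D0 r_gt0 c0 ab T_gt0 cy ysub yobst Y0 psic A_contact A_min).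
(* [lim] acquires its value only through the convergence just proved; from here the extension in the
   statement is [A_ext]. *)
have limA : lim (A s @[s --> 0^'+]) = ln K2 by exact/cvg_lim.
have extE : extend_at0 A = A_ext (ln K2) A.
  by apply/funext => t; rewrite /extend_at0 /A_ext limA.
split => //; last by rewrite /extend_at0 eqxx.
- move=> s t; rewrite !in_itv/= => /andP[s0 _] /andP[_ tT] st; rewrite extE.
  exact: (A_ext_strict D0 r_gt0 c0 ab T_gt0 kap0 cy yM ysuper ysub yobst Yl Y0
    psic psik A_contact A_min).
- rewrite extE.
  exact: (A_ext_continuous D0 r_gt0 c0 ab T_gt0 kap0 cy yM ysuper ysub yobst Yl Y0
    psic psik A_contact A_min).
Qed.
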